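(* Let $\mathcal{C}=\bigcup_n\mathcal{C}_n$ be a set of quantum states and $\mathcal{M}=\bigcup_n\mathcal{M}_n$ a set of two-outcome measurements, where $\mathcal{C}_n$ consists of $n$-qubit states and $\mathcal{M}_n$ of measurements on $n$ qubits. If there exists an efficient ontological model (EOM) for $\mathcal{C}$ under $\mathcal{M}$, then $\mathcal{C}$ is efficiently classically simulable with respect to $\mathcal{M}$.
   Context: Measurements are two-outcome POVMs, identified with their first POVM element $E$, so that the expected value on $\rho$ is $\mathrm{Tr}(E\rho)$. Ontological model: an ontological model with ontic state space $\Lambda_n$ describes $\mathcal{C}_n$ with respect to $\mathcal{M}_n$ if there exist a function $f:\Lambda_n\times\mathcal{M}_n\to[0,1]$ and, for each $\rho\in\mathcal{C}_n$, a probability distribution $p_\rho$ over $\Lambda_n$, such that $\mathrm{Tr}(\rho E)=\sum_{\lambda\in\Lambda_n}p_\rho(\lambda)f(\lambda,E)$ for all $\rho\in\mathcal{C}_n$ and $E\in\mathcal{M}_n$. Efficient ontological model (EOM) for $\mathcal{C}$ under $\mathcal{M}$: an ontological model (one for each $n$) such that $|\Lambda_n|=O(\mathrm{poly}(n))$ and there is a classical algorithm that evaluates $f(\lambda,E)$ and $p_\rho(\lambda)$, for all $\rho\in\mathcal{C}_n$, $\lambda\in\Lambda_n$, $E\in\mathcal{M}_n$, in runtime polynomial in $n$. The states and measurements are given to this algorithm through canonical classical descriptions of length at most $\mathrm{poly}(n)$. Efficient classical simulability: $\mathcal{C}$ is efficiently classically simulable with respect to $\mathcal{M}$ if (i) each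 $E\in\mathcal{M}_n$ has a canonical classical description of length at most $\mathrm{poly}(n)$; (ii) each $\rho\in\mathcal{C}_n$ has a canonical classical description of length at most $\mathrm{poly}(n)$; (iii) there is a classical (possibly randomized) algorithm that takes these descriptions as input and outputs $\mathrm{Tr}(E\rho)$ to additive error $\epsilon$; (iv) this algorithm has runtime polynomial in $n$ and $1/\epsilon$. *)

(* Defs.v *)
From mathcomp Require Import all_boot all_order all_algebra.
From mathcomp Require Import classical_sets reals.
From mathcomp Require Import complex.

Set Implicit Arguments.
Unset Strict Implicit.
Unset Printing Implicit Defensive.

Import Order.TTheory GRing.Theory Num.Theory.

Local Open Scope ring_scope.
Local Open Scope complex_scope.
Local Open Scope classical_set_scope.

(* The machine model: structured programs over finitely many stacks of bits.
   A program mentions finitely many stacks, has finite control, and every step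
   pushes, pops or inspects one bit on top of one stack.  Since a tape is a
   pair of stacks, step counts agree with those of (probabilistic) multitape
   Turing machines up to a constant factor. *)

Definition bitstring := seq bool.

Inductive cmd : Type :=
| Skip
| Push of nat & bool
| Pop of nat
| Flip of nat                        (* push a fair coin toss *)
| Seq of cmd & cmd
| Branch of nat & cmd & cmd & cmd    (* stack empty / top is 0 / top is 1 *)
| While of nat & cmd.                (* while the stack is nonempty *)

Fixpoint coin_free (P : cmd) : bool :=
  match P with
  | Flip _ => false
  | Seq P1 P2 => coin_free P1 && coin_free P2
  | Branch _ P1 P2 P3 => [&& coin_free P1, coin_free P2 & coin_free P3]
  | While _ P1 => coin_free P1
  | _ => true
  end.

Definition store := nat -> bitstring.

Definition set_stack (s : store) (r : nat) (v : bitstring) : store :=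
  fun r' => if r' == r then v else s r'.

(* A configuration consists of the commands still to be executed, the contents
   of the stacks, and the coin tosses not yet consumed. *)
Definition config := (seq cmd * store * bitstring)%type.

Definition step (cf : config) : config :=
  let: (k, s, w) := cf in
  match k with
  | [::] => cf
  | Skip :: k' => (k', s, w)
  | Push r b :: k' => (k', set_stack s r (b :: s r), w)
  | Pop r :: k' => (k', set_stack s r (behead (s r)), w)
  | Flip r :: k' => (k', set_stack s r (head false w :: s r), behead w)
  | Seq P1 P2 :: k' => (P1 :: P2 :: k', s, w)
  | Branch r P1 P2 P3 :: k' =>
      ((match s r with
        | [::] => P1
        | false :: _ => P2
        | true :: _ => P3
        end) :: k', s, w)
  | While r P1 :: k' =>
      (if nilp (s r) then k' else P1 :: While r P1 :: k', s, w)
  end.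

(* The inputs are placed on stacks 0, 1, 2, ..., the others being empty. *)
Definition run (P : cmd) (ins : seq bitstring) (w : bitstring) (t : nat) :
    config :=
  iter t step ([:: P], nth [::] ins, w).

(* [halted (run P ins w t)] says that P halts after at most t steps, since a
   configuration with no commands left is a fixed point of [step]. *)
Definition halted (cf : config) : bool := nilp cf.1.1.

Definition unary (k : nat) : bitstring := nseq k true.

(* Binary numerals, least significant bit first. *)
Fixpoint bin_val (s : bitstring) : nat :=
  if s is b :: s' then (b + (bin_val s').*2)%N else 0%N.

(* The output is the fraction whose numerator and denominator are the binary
   numerals left on stacks 0 and 1. *)
Definition out_num (cf : config) : nat := bin_val (cf.1.2 0%N).
Definition out_den (cf : config) : nat := bin_val (cf.1.2 1%N).

Definition poly_bound (c n : nat) : nat := (c * n.+1 ^ c)%N.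

Section Quantum.
Variable R : realType.

Definition outputs_within (cf : config) (x eps : R) : bool :=
  [&& halted cf, (0 < out_den cf)%N &
      `|(out_num cf)%:R / (out_den cf)%:R - x| <= eps].

Definition op (n : nat) := 'M[R[i]]_(2 ^ n).

Definition psd (m : nat) (A : 'M[R[i]]_m) : Prop :=
  A \is hermsymmx /\
  forall v : 'cV[R[i]]_m, 0 <= ((map_mx Num.conj v^T) *m A *m v) 0 0.

Definition is_state (n : nat) (rho : op n) : Prop := psd rho /\ \tr rho = 1.

(* E stands for the two-outcome POVM {E, 1 - E}. *)
Definition is_effect (n : nat) (E : op n) : Prop := psd E /\ psd (1%:M - E).

(* Tr(E rho), which is real when E and rho are Hermitian. *)
Definition expval (n : nat) (E rho : op n) : R := complex.Re (\tr (E *m rho)).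

Definition ontological_model (n : nat) (C M : set (op n)) (L : finType)
    (p : op n -> L -> R) (f : L -> op n -> R) : Prop :=
  [/\ forall lam E, M E -> 0 <= f lam E <= 1,
      forall rho, C rho ->
        (forall lam, 0 <= p rho lam) /\ \sum_lam p rho lam = 1
    & forall rho E, C rho -> M E ->
        \tr (rho *m E) = (\sum_lam p rho lam * f lam E)%:C].

Definition canonical_description (X : forall n, set (op n))
    (d : forall n, op n -> bitstring) : Prop :=
  (forall n A B, X n A -> X n B -> d n A = d n B -> A = B) /\
  exists c, forall n A, X n A -> (size (d n A) <= poly_bound c n)%N.

(* A real-valued function is evaluated in polynomial time when, given also k in
   unary, a deterministic machine outputs a rational within 2^-k of the value
   in time polynomial in n and k.  A machine that outputs the exact value in
   time polynomial in n, whatever k, is a special case.  An ontic state is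
   given through its rank in the enumeration of L n, in unary. *)
Definition efficient_ontological_model (C M : forall n, set (op n))
    (dC dM : forall n, op n -> bitstring) : Prop :=
  [/\ canonical_description C dC,
      canonical_description M dM
    & exists (L : nat -> finType) (p : forall n, op n -> L n -> R)
             (f : forall n, L n -> op n -> R),
      [/\ forall n, ontological_model (C n) (M n) (p n) (f n),
          exists c, forall n, (#|L n| <= poly_bound c n)%N,
          exists2 P : cmd, coin_free P &
            exists c, forall n k (rho : op n) (lam : L n), C n rho ->
              outputs_within
                (run P [:: dC n rho; unary (enum_rank lam); unary k] [::]
                     (poly_bound c (n + k)))
                (p n rho lam) (2 ^- k)
        & exists2 P : cmd, coin_free P &
            exists c, forall n k (lam : L n) (E : op n), M n E ->
              outputs_within
                (run P [:: unary (enum_rank lam); dM n E; unary k] [::]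
                     (poly_bound c (n + k)))
                (f n lam E) (2 ^- k)]].

(* Probability over T independent fair coin tosses. *)
Definition coin_prob (T : nat) (A : pred (T.-tuple bool)) : R :=
  #|A|%:R / 2 ^+ T.

(* The accuracy eps is communicated as the least integer greater than 1/eps. *)
Definition inv_accuracy (eps : R) : nat := (Num.truncn eps^-1).+1.

(* A randomized algorithm has worst-case running time T and errs with
   probability at most 1/3.  T steps consume at most T coin tosses. *)
Definition efficiently_simulable (C M : forall n, set (op n))
    (dC dM : forall n, op n -> bitstring) : Prop :=
  [/\ canonical_description M dM,
      canonical_description C dC
    & exists (P : cmd) (c : nat), forall n (eps : R) (rho E : op n),
        0 < eps -> C n rho -> M n E ->
        let m := inv_accuracy eps in
        let T := poly_bound c (n + m) in
        let result (w : T.-tuple bool) :=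
          run P [:: dC n rho; dM n E; unary m] w T in
        (forall w, halted (result w)) /\
        2 / 3 <= coin_prob (fun w => outputs_within (result w)
                                                    (expval E rho) eps)].

End Quantum.

(* Main.v *)
Require Import Defs.
From mathcomp Require Import all_boot all_order all_algebra.
From mathcomp Require Import zify ring lra.
From mathcomp Require Import boolp classical_sets reals complex.

(* The simulation is deterministic.  It enumerates the ontic states by rank
   i = 0, 1, 2, ..., evaluates p_rho and f on the i-th one to precision
   2^-(m + 4 + i), and accumulates the sum of the products as an exact fraction
   V / D.  The machine is told neither n nor the number of ontic states, so it
   does not know when the enumeration is over; it stops as soon as the
   accumulated probability U / D, started at the slack 1 / (2^(m + 3) - 1),
   reaches 1.  The errors being summable, this happens at the latest on the
   last ontic state, and the mass then left out is at most twice the slack. *)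

Set Implicit Arguments.
Unset Strict Implicit.
Unset Printing Implicit Defensive.

Import Order.TTheory GRing.Theory Num.Theory.

Local Open Scope nat_scope.

(** * Execution with a time bound *)

(** Overshooting would not be harmless: past the last rank the evaluation programs have no specified
    behaviour and may run forever. The stopping test must therefore fire in time, using only what
    has already been computed. The normalization of p_rho provides such a test up to evaluation
    errors. A precision that grows with i keeps their total below the slack whatever the number of
    ontic states, while a fixed precision would have to depend on that number. Exact fractions avoid
    division and rounding. Each round multiplies D by the two new denominators, whose lengths are
    bounded by input length plus running time; lengths thus grow additively and stay polynomial over
    polynomially many rounds. The slack owes its form to the fact that m + 3 ones, read in binary,
    are 2^(m + 3) - 1, so that the initial denominator is merely a copied stack. The final error is
    at most 5 times the slack, hence at most 1 / m, where m exceeds 1 / eps. *)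

(* Quantifying over k and w makes P usable as a subroutine that tosses no coin. *)
Definition exec (P : cmd) (s : store) (T : nat) (s' : store) : Prop :=
  exists2 t, t <= T &
    forall k w, iter t step (P :: k, s, w) = (k, s', w).

Lemma exec_le P s T s' T' : exec P s T s' -> T <= T' -> exec P s T' s'.
Proof. by case=> t le_tT Pt le_TT'; exists t => //; apply: leq_trans le_TT'. Qed.

Lemma exec_skip s : exec Skip s 1 s.
Proof. by exists 1. Qed.

Lemma exec_push r b s : exec (Push r b) s 1 (set_stack s r (b :: s r)).
Proof. by exists 1. Qed.

Lemma exec_pop r s : exec (Pop r) s 1 (set_stack s r (behead (s r))).
Proof. by exists 1. Qed.

Lemma exec_seq P Q s s1 s2 T1 T2 :
  exec P s T1 s1 -> exec Q s1 T2 s2 -> exec (Seq P Q) s (T1 + T2).+1 s2.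
Proof.
case=> t1 le1 E1 [t2 le2 E2]; exists (t2 + t1).+1; first by lia.
by move=> k w; rewrite iterSr iterD /= E1 E2.
Qed.

Lemma exec_branch r P1 P2 P3 s T s' :
  exec (match s r with
        | [::] => P1 | false :: _ => P2 | true :: _ => P3 end) s T s' ->
  exec (Branch r P1 P2 P3) s T.+1 s'.
Proof. by case=> t le_tT E; exists t.+1 => // k w; rewrite iterSr E. Qed.

Lemma exec_while0 r P s : s r = [::] -> exec (While r P) s 1 s.
Proof. by move=> sr; exists 1 => // k w; rewrite /= sr. Qed.

Lemma exec_while1 r P s s1 s2 T1 T2 : s r <> [::] ->
  exec P s T1 s1 -> exec (While r P) s1 T2 s2 ->
  exec (While r P) s (T1 + T2).+1 s2.
Proof.
move=> srN [t1 le1 E1] [t2 le2 E2].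
have sr : nilp (s r) = false by case: (s r) srN.
exists (t2 + t1).+1; first by lia.
by move=> k w; rewrite iterSr iterD /= sr E1 E2.
Qed.

Ltac split_regs :=
  rewrite ?eqxx; repeat match goal with
  | |- context [@eq_op _ ?a ?b] =>
      let e := fresh "e" in
      case: (@eqP _ a b) => e; [try first [subst | rewrite e]|]; rewrite ?eqxx; try by []; try lia
  end.

Ltac store_eq :=
  apply: funext => ?; rewrite /set_stack ?inE; split_regs.

Definition pushes (ys : seq nat) (b : bool) : cmd :=
  foldr (fun y => Seq (Push y b)) Skip ys.

Lemma exec_pushes (ys : seq nat) b s : uniq ys ->
  exec (pushes ys b) s (2 * size ys).+1
    (fun r => if r \in ys then b :: s r else s r).
Proof.
elim: ys s => [|y ys IH] s /=.
  by move=> _; exact: exec_skip.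
case/andP=> yNys uys.
have E := exec_seq (exec_push y b s) (IH (set_stack s y (b :: s y)) uys).
have -> : (fun r => if r \in y :: ys then b :: s r else s r) =
   (fun r => if r \in ys then b :: set_stack s y (b :: s y) r
             else set_stack s y (b :: s y) r).
  apply: funext => r; rewrite inE /set_stack.
  by case: eqP => [->|//]; rewrite (negPf yNys).
by apply: exec_le E _; lia.
Qed.

(** Reading a stack destroys it, and transferring it reverses it. Several targets are allowed so
    that a copy is two pours through stack 14, the second one also restoring the source; with no
    target a pour erases. *)
Definition pour (x : nat) (ys : seq nat) : cmd :=
  While x (Branch x Skip (Seq (Pop x) (pushes ys false))
                         (Seq (Pop x) (pushes ys true))).

Lemma exec_pour (x : nat) (ys : seq nat) s : uniq (x :: ys) ->
  exec (pour x ys) s ((2 * size ys + 5) * size (s x)).+1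
    (fun r => if r == x then [::]
              else if r \in ys then catrev (s x) (s r) else s r).
Proof.
move=> /= /andP[xNys uys].
move e: (s x) => v; elim: v s e => [|b v IH] s sx /=.
  suff -> : (fun r => if r == x then [::] else if r \in ys then s r else s r) = s.
    by rewrite muln0; apply: exec_while0.
  by apply: funext => r; case: eqP => [->|_]; rewrite ?sx ?if_same.
pose s1 := set_stack s x v.
pose s2 r := if r \in ys then b :: s1 r else s1 r.
have s2x : s2 x = v by rewrite /s2 (negPf xNys) /s1 /set_stack eqxx.
have E : exec (Branch x Skip (Seq (Pop x) (pushes ys false))
                         (Seq (Pop x) (pushes ys true))) s (2 * size ys + 4) s2.
  apply: exec_le (exec_branch (T := (1 + (2 * size ys).+1).+1) _) _; last by lia.
  rewrite sx; case: b @s2 {s2x} sx => s2 sx; apply: exec_seq (exec_pop _ _) _;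
  rewrite sx; exact: exec_pushes.
have := exec_while1 _ E (IH s2 s2x); rewrite sx => /(_ ltac:(by [])) W.
have -> : (fun r => if r == x then [::] else
     if r \in ys then catrev v (b :: s r) else s r) =
   (fun r => if r == x then [::] else if r \in ys then catrev v (s2 r) else s2 r).
  apply: funext => r; rewrite /s2 /s1 /set_stack.
  by case: eqP => // _; case: ifP.
by apply: exec_le W _; lia.
Qed.

(** * Binary arithmetic on stacks *)

(* Stack numbers.  0, 1: the descriptions of the state and of the measurement;
   2: precision, in unary; 3: rank of the ontic state, in unary; 4, 5, 6: the
   accumulators U, V, D; 7: nonempty as long as U < D; 8, 9, 10: the next values
   of U, V, D; 11, 12, 13: products used in computing them; 14 to 18: temporaries
   of the arithmetic, empty between operations; 20, 22, 24, ... and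
   21, 23, 25, ...: the stacks of the programs evaluating p and f. *)

Definition copy (x y : nat) : cmd := Seq (pour x [:: 14]) (pour 14 [:: x; y]).

Lemma exec_copy (x y : nat) s :
  x <> y -> x <> 14 -> y <> 14 -> s 14 = [::] -> s y = [::] ->
  exec (copy x y) s (16 * size (s x) + 3) (set_stack s y (s x)).
Proof.
move=> xy x14 y14 s14 sy.
have := exec_pour (x := x) (ys := [:: 14]) s.
rewrite /= inE => /(_ ltac:(by apply/andP; split; first apply/eqP)) E1.
set s1 := (fun r => _) in E1.
have := exec_pour (x := 14) (ys := [:: x; y]) s1.
rewrite /= !inE => /(_ ltac:(lia)) E2.
have s1_14 : s1 14 = rev (s x).
  by rewrite /s1; case: eqP => [/esym//|_]; rewrite inE /= s14.
rewrite s1_14 size_rev in E2.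
apply: exec_le (_ : exec _ _ _ _) (_ : ((2 + 5) * size (s x)).+1 + ((4 + 5) * size (s x)).+1 < _); last by lia.
have -> : set_stack s y (s x) = fun r => if r == 14 then [::] else
            if r \in [:: x; y] then catrev (rev (s x)) (s1 r) else s1 r.
  rewrite /s1; store_eq.
  all: rewrite ?sy /= ?catrevE ?revK ?cats0 //.
exact: exec_seq E1 E2.
Qed.

Definition bitop := bool -> bool -> bool -> bool.

(** Together with [xor3], [maj] is a full adder and [borrow] a full subtractor; of a subtraction
    only the last borrow is kept, as the outcome of a comparison. *)
Definition maj : bitop := fun a b c => (a && b) || (c && (a || b)).
Definition xor3 : bitop := fun a b c => a (+) b (+) c.
Definition borrow : bitop := fun a b c => (~~ a && b) || (c && (~~ a || b)).

(* Carry (or borrow), the two numerals still to be read, and the bits produced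
   so far, most significant first. *)
Definition zstate := (bool * bitstring * bitstring * bitstring)%type.

Definition zstep (cf og : bitop) (q : zstate) : zstate :=
  let: (c, u, v, t) := q in
  let: (a, b) := (head false u, head false v) in
  (cf a b c, behead u, behead v, og a b c :: t).

(** An empty stack counts as a 0 bit, in agreement with [head false] in [zstep]; this pads the
    shorter numeral. *)
Definition case_top (r : nat) (P : bool -> cmd) : cmd :=
  Branch r (P false) (P false) (P true).

Lemma exec_case_top r P s T s' :
  exec (P (head false (s r))) s T s' -> exec (case_top r P) s T.+1 s'.
Proof. by move=> E; apply: exec_branch; case: (s r) E => [|[]]. Qed.

Definition zip_body (cf og : bitop) (x y c t : nat) : cmd :=
  case_top x (fun a => case_top y (fun b => case_top c (fun d =>
    Seq (Pop x) (Seq (Pop y) (Seq (Pop c) (Seq (Push t (og a b d))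
      (if cf a b d then Push c true else Skip))))))).

(** A [While] tests a single stack, so the loop over [x] is followed by one over what is left of
    [y]; together they make [maxn] iterations. *)
Definition zip_loop (cf og : bitop) (x y c t : nat) : cmd :=
  Seq (While x (zip_body cf og x y c t)) (While y (zip_body cf og x y c t)).

(** The carry is stored in unary, 0 being the empty stack: the last carry can then be tested by a
    [Branch] or, after a comparison, serve as the guard of a [While]. *)
Definition put (x y c t : nat) (s : store) (q : zstate) : store :=
  let: (d, u, v, o) := q in
  set_stack (set_stack (set_stack (set_stack s x u) y v) c (nseq d true)) t o.

Lemma put_id x y c t s (d : bool) : s c = nseq d true -> put x y c t s (d, s x, s y, s t) = s.
Proof. by move=> sc; rewrite /put; store_eq. Qed.

Section Zip.
Variables (cf og : bitop) (x y c t : nat).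
Hypothesis uniq_regs : uniq [:: x; y; c; t].

Lemma put_regs s d u v o :
  [/\ put x y c t s (d, u, v, o) x = u, put x y c t s (d, u, v, o) y = v,
      put x y c t s (d, u, v, o) c = nseq d true
    & put x y c t s (d, u, v, o) t = o].
Proof.
move: uniq_regs; rewrite /= !inE => ?.
by rewrite /put /set_stack; split; split_regs.
Qed.

Lemma exec_zip_body s q :
  exec (zip_body cf og x y c t) (put x y c t s q) 12
    (put x y c t s (zstep cf og q)).
Proof.
case: q => [[[d u] v] o]; set s0 := put _ _ _ _ _ _.
have := put_regs s d u v o; rewrite -/s0 => -[sx sy sc st].
apply: exec_case_top; apply: exec_case_top; apply: exec_case_top.
rewrite sx sy sc.
have -> : head false (nseq d true) = d by case: d {s0 sx sy sc st}.
rewrite /zstep; set a := head _ _; set b := head _ _.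
pose s1 := set_stack s0 x (behead (s0 x)).
pose s2 := set_stack s1 y (behead (s1 y)).
pose s3 := set_stack s2 c (behead (s2 c)).
pose s4 := set_stack s3 t (og a b d :: s3 t).
have E5 : exec (if cf a b d then Push c true else Skip) s4 1
   (set_stack s4 c (nseq (cf a b d) true)).
  move: uniq_regs; rewrite /= !inE => ?.
  have s4c : s4 c = [::].
    rewrite /s4 /s3 /set_stack; split_regs.
    by rewrite /s2 /s1 /set_stack; split_regs; rewrite sc; case: (d).
  case: (cf a b d) => /=.
    by rewrite -[in [:: true]]s4c; apply: exec_push.
  suff -> : set_stack s4 c [::] = s4 by exact: exec_skip.
  by rewrite -s4c; store_eq.
have := exec_seq (exec_pop x s0) (exec_seq (exec_pop y s1) (exec_seq (exec_pop c s2)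
  (exec_seq (exec_push t (og a b d) s3) E5))).
set s5 := set_stack s4 _ _.
suff -> : s5 = put x y c t s (cf a b d, behead u, behead v, og a b d :: o) by [].
move: uniq_regs; rewrite /= !inE => ?.
rewrite /s5 /s4 /s3 /s2 /s1 /put; store_eq; rewrite ?sx ?sy ?st //.
by rewrite /s0 /put /set_stack; split_regs.
Qed.

Lemma exec_zip_while1 s d u v o :
  exec (While x (zip_body cf og x y c t)) (put x y c t s (d, u, v, o))
    (13 * size u).+1
    (put x y c t s (iter (size u) (zstep cf og) (d, u, v, o))).
Proof.
elim: u d v o => [|a u IH] d v o.
  by have [sx _ _ _] := put_regs s d [::] v o; exact: exec_while0.
have [sx _ _ _] := put_regs s d (a :: u) v o.
rewrite [size _]/= iterSr.
have E := exec_zip_body s (d, a :: u, v, o).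
by apply: exec_le (exec_while1 _ E (IH _ _ _)) _; [rewrite sx | lia].
Qed.

Lemma exec_zip_while2 s d v o :
  exec (While y (zip_body cf og x y c t)) (put x y c t s (d, [::], v, o))
    (13 * size v).+1
    (put x y c t s (iter (size v) (zstep cf og) (d, [::], v, o))).
Proof.
elim: v d o => [|b v IH] d o.
  by have [_ sy _ _] := put_regs s d [::] [::] o; exact: exec_while0.
have [_ sy _ _] := put_regs s d [::] (b :: v) o.
rewrite [size _]/= iterSr.
have E := exec_zip_body s (d, [::], b :: v, o).
by apply: exec_le (exec_while1 _ E (IH _ _)) _; [rewrite sy | lia].
Qed.

Lemma iter_zstep_stacks n d u v o :
  exists d' o', iter n (zstep cf og) (d, u, v, o) = (d', drop n u, drop n v, o')
    /\ size o' = n + size o.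
Proof.
elim: n => [|n [d' [o' [E so]]]]; first by exists d, o; rewrite !drop0.
rewrite iterS E /=; eexists; eexists; split.
  by rewrite -!drop1 !drop_drop !add1n.
by rewrite /= so.
Qed.

Lemma exec_zip_loop s (d : bool) : s c = nseq d true ->
  exec (zip_loop cf og x y c t) s (13 * (size (s x) + size (s y)) + 3)
   (put x y c t s
     (iter (maxn (size (s x)) (size (s y))) (zstep cf og) (d, s x, s y, s t))).
Proof.
move=> sc; rewrite maxnE [in iter _]addnC iterD.
have := exec_zip_while1 s d (s x) (s y) (s t).
have [d' [o' [E _]]] := iter_zstep_stacks (size (s x)) d (s x) (s y) (s t).
rewrite put_id // E drop_size => E1.
have := exec_zip_while2 s d' (drop (size (s x)) (s y)) o'.
rewrite size_drop => E2.
by apply: exec_le (exec_seq E1 E2) _; lia.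
Qed.
End Zip.

Definition bin_add (u v : bitstring) : bitstring :=
  let: (d, _, _, o) := iter (maxn (size u) (size v)) (zstep maj xor3) (false, u, v, [::]) in
  rev (nseq d true ++ o).

Definition bin_lt (u v : bitstring) : bool :=
  (iter (maxn (size u) (size v)) (zstep borrow xor3) (false, u, v, [::])).1.1.1.

Lemma bin_val_cat u v : bin_val (u ++ v) = bin_val u + 2 ^ size u * bin_val v.
Proof.
elim: u => [|b u IH] /=; first by rewrite mul1n.
by rewrite IH expnS; lia.
Qed.

Lemma bin_val_head u : bin_val u = head false u + (bin_val (behead u)).*2.
Proof. by case: u. Qed.

Lemma size_bin_add u v : size (bin_add u v) <= (maxn (size u) (size v)).+1.
Proof.
rewrite /bin_add; set n := maxn _ _.
have [d [o [-> so]]] := iter_zstep_stacks maj xor3 n false u v [::].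
by rewrite size_rev size_cat so /=; case: d; rewrite /= ?addn0; lia.
Qed.

Lemma bin_val_add u v : bin_val (bin_add u v) = bin_val u + bin_val v.
Proof.
(* Invariant of the addition: the bits already produced, plus the pending carry and the unread
   numerals shifted by the number of these bits. *)
pose val (q : zstate) := let: (d, u, v, o) := q in
  bin_val (rev o) + 2 ^ size o * (d + bin_val u + bin_val v).
have val_step q : val (zstep maj xor3 q) = val q.
  case: q => [[[d u'] v'] o]; rewrite /val /zstep.
  rewrite (bin_val_head u') (bin_val_head v') rev_cons -cats1 bin_val_cat size_rev /= expnS.
  move: (2 ^ size o) (bin_val _) (bin_val _) (bin_val _) => k x y z.
  case: (head false u'); case: (head false v'); case: d; rewrite /= /xor3 /maj /=; lia.
have val_iter n q : val (iter n (zstep maj xor3) q) = val q.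
  by elim: n => //= n IH; rewrite val_step.
rewrite /bin_add; set n := maxn _ _.
have := val_iter n (false, u, v, [::]).
have [d [o [-> so]]] := iter_zstep_stacks maj xor3 n false u v [::].
rewrite /val !drop_oversize ?leq_maxl ?leq_maxr //= add0n mul1n => <-.
by rewrite rev_cat bin_val_cat size_rev; case: d.
Qed.

Lemma bin_ltE u v : bin_lt u v = (bin_val u < bin_val v).
Proof.
(* The unread parts are the more significant ones, so they decide the comparison, and the borrow so
   far only breaks a tie. *)
pose val (q : zstate) := let: (d, u, v, o) := q in
  (bin_val u < bin_val v) || ((bin_val u == bin_val v) && d).
have val_step q : val (zstep borrow xor3 q) = val q.
  case: q => [[[d u'] v'] o]; rewrite /val /zstep.
  rewrite (bin_val_head u') (bin_val_head v') /=.
  move: (bin_val _) (bin_val _) => k x.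
  case: (head false u'); case: (head false v'); case: d; rewrite /= /borrow /=; lia.
have val_iter n q : val (iter n (zstep borrow xor3) q) = val q.
  by elim: n => //= n IH; rewrite val_step.
rewrite /bin_lt; set n := maxn _ _.
have := val_iter n (false, u, v, [::]).
have [d [o [-> so]]] := iter_zstep_stacks borrow xor3 n false u v [::].
by rewrite /val !drop_oversize ?leq_maxl ?leq_maxr //= andbF orbF.
Qed.

(** The zip loop consumes [z] and leaves the sum on stack 14 with its most significant bit on top; a
    final carry becomes one more top bit, and pouring restores the order. *)
Definition addto (z w : nat) : cmd :=
  Seq (copy w 15) (Seq (zip_loop maj xor3 z 15 16 14)
  (Seq (Branch 16 Skip Skip (Seq (Pop 16) (Push 14 true))) (pour 14 [:: z]))).

Lemma exec_addto z w s B :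
  z <> w -> z \notin iota 14 5 -> w \notin iota 14 3 ->
  s 14 = [::] -> s 15 = [::] -> s 16 = [::] ->
  size (s z) <= B -> size (s w) <= B ->
  exec (addto z w) s (60 * B.+1) (set_stack s z (bin_add (s z) (s w))).
Proof.
rewrite !inE => zw zN wN s14 s15 s16 zB wB.
have E1 := @exec_copy w 15 s ltac:(lia) ltac:(lia) ltac:(lia) s14 s15.
set s1 := set_stack s 15 (s w) in E1.
have s1z : s1 z = s z by rewrite /s1 /set_stack; split_regs.
have := @exec_zip_loop maj xor3 z 15 16 14 _ s1 false.
have s1_15 : s1 15 = s w by [].
have s1_14 : s1 14 = [::] by rewrite -s14.
have s1_16 : s1 16 = [::] by rewrite -s16.
rewrite s1z s1_15 s1_14 => /(_ ltac:(rewrite /= !inE; lia) s1_16) E2.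
pose n := maxn (size (s z)) (size (s w)).
have [d [o [E so]]] := iter_zstep_stacks maj xor3 n false (s z) (s w) [::].
have Ea : bin_add (s z) (s w) = rev (nseq d true ++ o) by rewrite /bin_add E.
rewrite -/n E !drop_oversize ?leq_maxl ?leq_maxr // in E2.
set s2 := put _ _ _ _ _ _ in E2.
have s2_16 : s2 16 = nseq d true by rewrite /s2 /put /set_stack.
pose s3 := set_stack (set_stack s2 16 [::]) 14 (nseq d true ++ o).
have E3 : exec (Branch 16 Skip Skip (Seq (Pop 16) (Push 14 true))) s2 4 s3.
  apply: exec_branch; rewrite /s3; move: s2_16; case: (d) => s2_16; rewrite s2_16.
    have := exec_push 14 true (set_stack s2 16 [::]).
    rewrite (_ : set_stack s2 16 [::] 14 = o) // => E3.
    have := exec_pop 16 s2; rewrite s2_16 /= => E0.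
    exact: exec_seq E0 E3.
  have {1}-> : s2 = set_stack (set_stack s2 16 [::]) 14 ([::] ++ o).
    by store_eq.
  by apply: exec_le (exec_skip _) _.
have := @exec_pour 14 [:: z] s3.
have s3_14 : s3 14 = nseq d true ++ o by rewrite /s3 /set_stack.
rewrite s3_14 => /(_ ltac:(rewrite /= !inE; lia)) E4.
have -> : set_stack s z (bin_add (s z) (s w)) = fun r : nat =>
     if r == 14 then [::]
     else if r \in [:: z] then catrev (nseq d true ++ o) (s3 r) else s3 r.
  rewrite Ea /s3 /s2 /put /s1; store_eq.
apply: exec_le (exec_seq E1 (exec_seq E2 (exec_seq E3 E4))) _.
rewrite size_cat size_nseq so /= addn0.
have : n <= B by rewrite geq_max zB.
by case: (d); lia.
Qed.

(** Shift-and-add: with the least significant bit first, prepending a 0 doubles [y]. *)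
Fixpoint bin_mac (z x y : bitstring) : bitstring :=
  if x is b :: x' then bin_mac (if b then bin_add z y else z) x' (false :: y) else z.

Lemma bin_val_mac z x y : bin_val (bin_mac z x y) = bin_val z + bin_val x * bin_val y.
Proof.
elim: x z y => [|b x IH] z y /=; first by rewrite addn0.
by rewrite IH /=; case: b; rewrite ?bin_val_add; lia.
Qed.

(** Each round consumes a bit of [x] and raises the larger of the lengths of [z] and [y] by at most
    one. *)
Lemma size_bin_mac z x y :
  size (bin_mac z x y) <= maxn (size z) (size y) + size x.
Proof.
elim: x z y => [|b x IH] z y /=; first by lia.
apply: leq_trans (IH _ _) _.
by have := size_bin_add z y; case: b => /=; lia.
Qed.

Definition mac_loop (z : nat) : cmd :=
  While 17 (Seq (Branch 17 Skip Skip (addto z 18)) (Seq (Pop 17) (Push 18 false))).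

Definition mac (z x y : nat) : cmd :=
  Seq (copy x 17) (Seq (copy y 18) (Seq (mac_loop z) (pour 18 [::]))).

(** The quantity bounded by [B] never increases: a round shortens stack 17 by one bit and lengthens
    the longer of the other two by at most one. One [B] therefore serves all the additions. *)
Lemma exec_mac_loop z s B : z \notin iota 14 5 ->
  s 14 = [::] -> s 15 = [::] -> s 16 = [::] ->
  maxn (size (s z)) (size (s 18)) + size (s 17) <= B ->
  exec (mac_loop z) s ((60 * B.+1 + 7) * size (s 17)).+1
    (set_stack (set_stack (set_stack s 17 [::])
       18 (nseq (size (s 17)) false ++ s 18)) z (bin_mac (s z) (s 17) (s 18))).
Proof.
rewrite !inE => zN; move e: (s 17) => x.
elim: x s e => [|b x IH] s e s14 s15 s16 leB /=.
  rewrite muln0; set s' := set_stack _ _ _.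
  suff -> : s' = s by exact: exec_while0.
  by rewrite /s'; store_eq.
pose s1 := if b then set_stack s z (bin_add (s z) (s 18)) else s.
have s1z : s1 z = if b then bin_add (s z) (s 18) else s z.
  by rewrite /s1; case: (b); rewrite // /set_stack eqxx.
have s1N r : r <> z -> s1 r = s r.
  by rewrite /s1 /set_stack; case: (b) => // rz; case: eqP.
have E1 : exec (Branch 17 Skip Skip (addto z 18)) s (60 * B.+1).+1 s1.
  apply: exec_branch; rewrite e /s1; case: (b); last by apply: exec_le (exec_skip _) _; lia.
  apply: exec_addto => //; rewrite /= ?inE; try lia.
pose s2 := set_stack (set_stack s1 17 x) 18 (false :: s 18).
have E2 : exec (Seq (Pop 17) (Push 18 false)) s1 3 s2.
  have := exec_seq (exec_pop 17 s1) (exec_push 18 false (set_stack s1 17 (behead (s1 17)))).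
  by rewrite {3}/set_stack /= !s1N ?e //; lia.
have s2z : s2 z = s1 z by rewrite /s2 /set_stack; split_regs.
have s2_17 : s2 17 = x by [].
have s2_18 : s2 18 = false :: s 18 by [].
have s2_14 : s2 14 = [::] by rewrite -s14 -(s1N 14) //; lia.
have s2_15 : s2 15 = [::] by rewrite -s15 -(s1N 15) //; lia.
have s2_16 : s2 16 = [::] by rewrite -s16 -(s1N 16) //; lia.
have /= leB' := leB.
have := IH s2 s2_17 s2_14 s2_15 s2_16.
rewrite s2z s2_18 s1z => /(_ ltac:(by have := size_bin_add (s z) (s 18); case: (b); rewrite /=; lia)) E3.
have W := exec_while1 _ (exec_seq E1 E2) E3.
apply: exec_le (_ : exec _ _ _ _) (_ : ((60 * B.+1).+1 + 3).+1 + ((60 * B.+1 + 7) * size x).+1 < _); last by lia.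
move: W; rewrite e => /(_ ltac:(by [])).
congr exec; rewrite /s2 /s1; case: (b); rewrite /set_stack; store_eq.
all: by rewrite -[false :: _ ++ _]cat1s catA (_ : [:: false] ++ nseq _ _ = nseq (size x) false ++ [:: false]) -?catA //; elim: (x) => //= ? ? ->.
Qed.

Lemma exec_mac z x y s B :
  z \notin iota 14 5 -> x \notin iota 14 5 -> y \notin iota 14 5 ->
  (forall r, r \in iota 14 5 -> s r = [::]) ->
  maxn (size (s z)) (size (s y)) + size (s x) <= B ->
  exec (mac z x y) s (100 * B.+1 ^ 2) (set_stack s z (bin_mac (s z) (s x) (s y))).
Proof.
move=> zN xN yN temps leB.
have [[s14 s15] s16 s17 s18] : [/\ s 14 = [::] /\ s 15 = [::], s 16 = [::], s 17 = [::] & s 18 = [::]].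
  by split; [split|..]; apply: temps.
move: zN xN yN; rewrite !inE => zN xN yN.
have E1 := @exec_copy x 17 s ltac:(lia) ltac:(lia) ltac:(lia) s14 s17.
set s1 := set_stack _ _ _ in E1.
have s1y : s1 y = s y by rewrite /s1 /set_stack; split_regs.
have E2 := @exec_copy y 18 s1 ltac:(lia) ltac:(lia) ltac:(lia) s14 s18.
set s2 := set_stack _ _ _ in E2.
have s2z : s2 z = s z by rewrite /s2 /s1 /set_stack; split_regs.
have s2x : s2 17 = s x by rewrite /s2 /s1 /set_stack.
have s2y : s2 18 = s y by rewrite -s1y.
have := @exec_mac_loop z s2 B.
rewrite s2z s2x s2y.
move=> /(_ ltac:(by rewrite !inE) s14 s15 s16 leB) E3.
set s3 := set_stack _ z _ in E3.
have E4 := @exec_pour 18 [::] s3 ltac:(by []).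
have s3_18 : s3 18 = nseq (size (s x)) false ++ s y.
  by rewrite /s3 /set_stack; split_regs.
rewrite s1y in E2; rewrite s3_18 size_cat size_nseq in E4.
have -> : set_stack s z (bin_mac (s z) (s x) (s y)) = fun r =>
   if r == 18 then [::] else if r \in [::] then catrev (nseq (size (s x)) false ++ s y) (s3 r) else s3 r.
  by rewrite /s3 /s2 /s1; store_eq.
apply: exec_le (exec_seq E1 (exec_seq E2 (exec_seq E3 E4))) _.
rewrite /=; move: leB; move: (size (s x)) (size (s y)) (size (s z)) => a b c leB.
have aB : a <= B by lia.
have bB : b <= B by lia.
have : (60 * B.+1 + 7) * a <= (60 * B.+1 + 7) * B by rewrite leq_mul2l aB orbT.
rewrite -mulnn; lia.
Qed.

(** * Subroutines on private stacks *)

Fixpoint rename (rho : nat -> nat) (P : cmd) : cmd :=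
  match P with
  | Skip => Skip
  | Push r b => Push (rho r) b
  | Pop r => Pop (rho r)
  | Flip r => Flip (rho r)
  | Seq P1 P2 => Seq (rename rho P1) (rename rho P2)
  | Branch r P1 P2 P3 =>
      Branch (rho r) (rename rho P1) (rename rho P2) (rename rho P3)
  | While r P1 => While (rho r) (rename rho P1)
  end.

(** Evaluation programs may leave garbage behind; [width] bounds the stacks they can touch, hence
    those to be cleared before the next call. *)
Fixpoint width (P : cmd) : nat :=
  match P with
  | Skip => 0
  | Push r _ | Pop r | Flip r => r.+1
  | Seq P1 P2 => maxn (width P1) (width P2)
  | Branch r P1 P2 P3 =>
      maxn r.+1 (maxn (width P1) (maxn (width P2) (width P3)))
  | While r P1 => maxn r.+1 (width P1)
  end.

Lemma iter_step_halted t cf : halted cf -> iter t step cf = cf.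
Proof. by case: cf => [[[|//] s] w] _; elim: t => //= t ->. Qed.

Lemma step_coin_free k s w : all coin_free k ->
  all coin_free (step (k, s, w)).1.1.
Proof.
case: k => [//|[|r b|r|r|P Q|r P Q T|r P] k] //=.
- by rewrite -andbA.
- by case/andP=> /and3P[? ? ?] ->; rewrite andbT; case: (s r) => [|[]].
- by case/andP=> cP ck; case: nilp; rewrite //= cP ck.
Qed.

Lemma step_width N k s w r :
  all (fun P => width P <= N) k -> N <= r ->
  all (fun P => width P <= N) (step (k, s, w)).1.1 /\
  (step (k, s, w)).1.2 r = s r.
Proof.
move=> kN leNr; case: k kN => [//|[|r' b|r'|r'|P Q|r' P Q T|r' P] k] //=;
  rewrite ?geq_max -?andbA.
- by case/andP=> lt_r' ->; split => //; rewrite /set_stack; split_regs.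
- by case/andP=> lt_r' ->; split => //; rewrite /set_stack; split_regs.
- by case/andP=> lt_r' ->; split => //; rewrite /set_stack; split_regs.
- by move=> ->.
- by case/and5P=> _ ? ? ? ->; split => //; rewrite andbT; case: (s r') => [|[]].
- by case/and3P=> r'N PN kN; split => //; case: nilp; rewrite //= geq_max r'N PN.
Qed.

Lemma iter_step_width t N k s w r :
  all (fun P => width P <= N) k -> N <= r ->
  (iter t step (k, s, w)).1.2 r = s r.
Proof.
elim: t k s w => [//|t IH] k s w kN leNr; rewrite iterSr.
have [] := step_width s w kN leNr.
by case: (step _) => [[k1 s1] w1] /= k1N <-; exact: IH.
Qed.

Lemma run_width P ins t r : width P <= r -> size ins <= r ->
  (run P ins [::] t).1.2 r = [::].
Proof.
move=> le_r le_ins; rewrite /run (@iter_step_width t (width P)) //= ?leqnn //.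
by rewrite nth_default.
Qed.

Lemma size_step k s w r : size ((step (k, s, w)).1.2 r) <= (size (s r)).+1.
Proof.
by case: k => [//|[|r' b|r'|r'|P Q|r' P Q T|r' P] k] //=;
   rewrite /set_stack; split_regs; rewrite //= size_behead; lia.
Qed.

(** A step adds at most one bit to a stack, so running time controls the length of the numerators
    and denominators that the evaluation programs return. *)
Lemma size_run P ins w t r :
  size ((run P ins w t).1.2 r) <= size (nth [::] ins r) + t.
Proof.
rewrite /run; elim: t => [|t IH] /=; first by rewrite addn0.
move: IH; case: (iter _ _ _) => [[k s] w'] /= IH.
by apply: leq_trans (size_step _ _ _ _) _; rewrite addnS.
Qed.

Section Rename.
Variables (rho : nat -> nat) (rhoV : nat -> option nat).
Hypothesis rhoK : pcancel rho rhoV.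
Hypothesis rhoVK : ocancel rhoV rho.

Definition embed (S s : store) : store :=
  fun r => if rhoV r is Some q then s q else S r.

Lemma embed_rho S s r : embed S s (rho r) = s r.
Proof. by rewrite /embed rhoK. Qed.

Lemma embed_set S s r v :
  embed S (set_stack s r v) = set_stack (embed S s) (rho r) v.
Proof.
apply: funext => r'; rewrite /embed /set_stack.
have := rhoVK r'; case e: (rhoV r') => [q|] /=.
  by move=> <-; rewrite (can_eq (g := odflt 0 \o rhoV)) // => x /=; rewrite rhoK.
by move=> _; case: eqP => // r'E; rewrite r'E rhoK in e.
Qed.

Lemma step_rename P0 k0 k S s w :
  all coin_free (P0 :: k0) ->
  step (map (rename rho) (P0 :: k0) ++ k, embed S s, w) =
  let: (k1, s1, _) := step (P0 :: k0, s, [::]) in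
  (map (rename rho) k1 ++ k, embed S s1, w).
Proof.
case: P0 => [|r b|r|r|P Q|r P Q T|r P] //= _; rewrite ?embed_set ?embed_rho //.
- by case: (s r) => [|[]].
- by case: nilp.
Qed.

(** The step count has to be exact: a halted [run] idles, but inside a larger program a further step
    would start the continuation [k]. Coin-freeness makes the run without tosses representative of
    every [w]. *)
Lemma iter_rename t k0 S s :
  all coin_free k0 -> halted (iter t step (k0, s, [::])) ->
  exists2 t', t' <= t & forall k w,
    iter t' step (map (rename rho) k0 ++ k, embed S s, w) =
    (k, embed S (iter t step (k0, s, [::])).1.2, w).
Proof.
elim: t k0 s => [|t IH] [|P0 k0] s cf //.
- by move=> _; exists 0.
- by move=> _; exists 0 => // k w; rewrite [iter t.+1 _ _]iter_step_halted.
rewrite iterSr => hlt.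
have cf1 := step_coin_free s [::] cf.
have stepE k w := step_rename k S s w cf.
have w1 : (step (P0 :: k0, s, [::])).2 = [::].
  move: cf; case: (P0) => [|r b|r|r|P Q|r P Q T|r P] //=.
move: stepE cf1 hlt w1; case: (step _) => [[k1 s1] w1] stepE /= cf1 hlt w1E.
rewrite {}w1E in hlt *.
have [t' le_t' E] := IH _ _ cf1 hlt.
by exists t'.+1 => // k w; rewrite iterSr stepE E.
Qed.

Lemma exec_rename P ins t S :
  coin_free P -> halted (run P ins [::] t) ->
  exec (rename rho P) (embed S (nth [::] ins)) t
    (embed S (run P ins [::] t).1.2).
Proof.
move=> cf hlt; have [|t' le_t' E] := iter_rename S _ hlt; first by rewrite /= cf.
by exists t'.
Qed.
End Rename.

(** Interleaving gives each program an unlimited supply of stacks and puts the outputs on 20, 22 and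
    21, 23, whatever the widths of the programs. *)
Definition zone (b : bool) (r : nat) : nat := 20 + b + r.*2.
Definition unzone (b : bool) (r : nat) : option nat :=
  if (20 + b <= r) && ~~ odd (r - (20 + b)) then Some (r - (20 + b))./2 else None.

Lemma zoneK b : pcancel (zone b) (unzone b).
Proof.
by move=> r; rewrite /unzone /zone leq_addr addKn odd_double doubleK.
Qed.

Lemma unzoneK b : ocancel (unzone b) (zone b).
Proof.
move=> r; rewrite /unzone; case: ifP => //= /andP[le_r /negPf ev].
by have := odd_double_half (r - (20 + b)); rewrite ev add0n /zone => ->; rewrite subnKC.
Qed.

Definition call (b : bool) (P : cmd) (x0 x1 x2 : nat) : cmd :=
  Seq (copy x0 (zone b 0)) (Seq (copy x1 (zone b 1)) (Seq (copy x2 (zone b 2))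
    (rename (zone b) P))).

Lemma exec_call b P x0 x1 x2 S t B :
  coin_free P -> x0 < 14 -> x1 < 14 -> x2 < 14 -> S 14 = [::] ->
  (forall r, S (zone b r) = [::]) ->
  size (S x0) <= B -> size (S x1) <= B -> size (S x2) <= B -> t <= B ->
  halted (run P [:: S x0; S x1; S x2] [::] t) ->
  exec (call b P x0 x1 x2) S (49 * B + 12)
    (embed (unzone b) S (run P [:: S x0; S x1; S x2] [::] t).1.2).
Proof.
move=> cf x0N x1N x2N S14 Sz b0 b1 b2 tB hlt.
have E0 := @exec_copy x0 (zone b 0) S ltac:(rewrite /zone; lia) ltac:(lia) ltac:(rewrite /zone; lia) S14 (Sz _).
set s1 := set_stack _ _ _ in E0.
have s1E r : r < 20 -> s1 r = S r by rewrite /s1 /set_stack /zone; split_regs.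
have s1z : s1 (zone b 1) = [::] by rewrite -(Sz 1) /s1 /set_stack /zone; split_regs.
have s1_14 : s1 14 = [::] by rewrite s1E.
have E1 := @exec_copy x1 (zone b 1) s1 ltac:(rewrite /zone; lia) ltac:(lia) ltac:(rewrite /zone; lia) s1_14 s1z.
rewrite s1E in E1; last by lia.
set s2 := set_stack _ _ _ in E1.
have s2E r : r < 20 -> s2 r = S r.
  by move=> r20; rewrite -s1E // /s2 /set_stack /zone; split_regs.
have s2z : s2 (zone b 2) = [::] by rewrite -(Sz 2) /s2 /s1 /set_stack /zone; split_regs.
have s2_14 : s2 14 = [::] by rewrite s2E.
have E2 := @exec_copy x2 (zone b 2) s2 ltac:(rewrite /zone; lia) ltac:(lia) ltac:(rewrite /zone; lia) s2_14 s2z.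
rewrite s2E in E2; last by lia.
have E3 := exec_rename (@zoneK b) (@unzoneK b) S cf hlt.
set s3 := set_stack _ _ _ in E2.
have s3E : s3 = embed (unzone b) S (nth [::] [:: S x0; S x1; S x2]).
  apply: funext => r; rewrite /embed.
  have := @unzoneK b r; case e: (unzone b r) => [q|] /=.
    move=> <-; rewrite /s3 /s2 /s1 /set_stack.
    by case: q e => [|[|[|q]]] e; rewrite /= ?nth_nil -?(Sz q.+3) /zone; split_regs.
  move=> _; rewrite /s3 /s2 /s1 /set_stack.
  by do 3 (case: eqP => [rE|_]; first by rewrite rE zoneK in e).
rewrite -s3E in E3.
(* Three copies at [16 * B + 3], at most [B] steps of [P], and one step for each [Seq]. *)
by apply: exec_le (exec_seq E0 (exec_seq E1 (exec_seq E2 E3))) _; lia.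
Qed.

Definition clear (l : seq nat) : cmd :=
  foldr (fun r => Seq (pour r [::])) Skip l.

Lemma exec_clear (l : seq nat) s B : (forall r, r \in l -> size (s r) <= B) ->
  exec (clear l) s ((5 * B + 2) * size l).+1
    (fun r => if r \in l then [::] else s r).
Proof.
elim: l s => [|x l IH] s sB; first exact: exec_le (exec_skip s) _.
have E1 := @exec_pour x [::] s ltac:(by []).
have sxB : size (s x) <= B by apply: sB; rewrite mem_head.
set s1 := (fun r => _) in E1.
have E2 : exec (clear l) s1 ((5 * B + 2) * size l).+1 (fun r => if r \in l then [::] else s1 r).
  apply: IH => r rl; rewrite /s1; case: eqP => // _.
  by apply: sB; rewrite inE rl orbT.
have -> : (fun r => if r \in x :: l then [::] else s r) =
   fun r => if r \in l then [::] else s1 r.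
  apply: funext => r; rewrite inE /s1; case: eqP => //= _; by case: ifP.
apply: exec_le (exec_seq E1 E2) _; rewrite /= [_ * (size l).+1]mulnS; lia.
Qed.

(** * The simulation loop *)

Definition bin_mul (x y : bitstring) : bitstring := bin_mac [::] x y.
(** The numerator of x / y + e / q over the denominator q * y. Taking for [q] the product of both
    new denominators lets U and V keep the common denominator D. *)
Definition bin_comb (q x e y : bitstring) : bitstring := bin_mac (bin_mul q x) e y.

Lemma size_bin_mul x y : size (bin_mul x y) <= size x + size y.
Proof. by have := size_bin_mac [::] x y; rewrite max0n addnC. Qed.

(* The values of p and f are read as the fractions 20 / 22 and 21 / 23. *)
Definition update_sums : cmd :=
  foldr Seq Skip [:: mac 11 22 23; mac 12 20 23; mac 13 20 21; mac 8 11 4;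
    mac 8 12 6; mac 9 11 5; mac 9 13 6; mac 10 11 6].

Lemma exec_update_sums s S H :
  (forall r, 8 <= r < 19 -> s r = [::]) ->
  (forall r, 20 <= r < 24 -> size (s r) <= S) ->
  (forall r, 4 <= r < 7 -> size (s r) <= H) ->
  let q := bin_mul (s 22) (s 23) in
  let e := bin_mul (s 20) (s 23) in
  let g := bin_mul (s 20) (s 21) in
  exists s', [/\ exec update_sums s (800 * (H + 4 * S).+1 ^ 2 + 9) s',
    forall r, 8 <= r < 14 -> size (s' r) <= H + 4 * S,
    forall r, r < 8 \/ 14 <= r -> s' r = s r &
    [/\ s' 8 = bin_comb q (s 4) e (s 6), s' 9 = bin_comb q (s 5) g (s 6)
      & s' 10 = bin_mul q (s 6)]].
Proof.
move=> s0 sS sH q e g.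
(* Products of two answers have at most [2 * S] bits, such a product times an accumulator at most
   [H + 2 * S], and accumulating a second product adds at most [2 * S]. *)
pose X := H + 4 * S.
have szM x y : size (bin_mul x y) <= size y + size x by rewrite addnC size_bin_mul.
have [sa sb sc sd] : [/\ size (s 20) <= S, size (s 22) <= S, size (s 21) <= S & size (s 23) <= S].
  by split; apply: sS.
have [sU sV sD] : [/\ size (s 4) <= H, size (s 5) <= H & size (s 6) <= H].
  by split; apply: sH.
have sq : size q <= 2 * S by rewrite /q; have := szM (s 22) (s 23); lia.
have se : size e <= 2 * S by rewrite /e; have := szM (s 20) (s 23); lia.
have sg : size g <= 2 * S by rewrite /g; have := szM (s 20) (s 21); lia.
have sqx x : size x <= H -> size (bin_mul q x) <= H + 2 * S.
  by move=> ?; have := szM q x; lia.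
have scomb e' x : size x <= H -> size e' <= 2 * S -> size (bin_comb q x e' (s 6)) <= X.
  move=> ? ?; have := size_bin_mac (bin_mul q x) e' (s 6); have := sqx x.
  by rewrite /X /bin_comb; lia.
pose temps (s : store) := forall r, r \in iota 14 5 -> s r = [::].
have temps_set s1 z v : z < 14 -> temps s1 -> temps (set_stack s1 z v).
  by move=> zN t1 r rt; rewrite /set_stack; case: eqP => [rz|_]; [move: rt; rewrite mem_iota; lia | exact: t1].
have tm0 : temps s by move=> r; rewrite mem_iota => ?; apply: s0; lia.
have step z x y s1 : z < 14 -> x \notin iota 14 5 -> y \notin iota 14 5 -> temps s1 ->
    maxn (size (s1 z)) (size (s1 y)) + size (s1 x) <= X ->
    exec (mac z x y) s1 (100 * X.+1 ^ 2) (set_stack s1 z (bin_mac (s1 z) (s1 x) (s1 y))).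
  by move=> zN ? ? ? ?; apply: exec_mac => //; rewrite mem_iota; lia.
have [z8 z9 z10] : [/\ s 8 = [::], s 9 = [::] & s 10 = [::]] by split; apply: s0.
have [z11 z12 z13] : [/\ s 11 = [::], s 12 = [::] & s 13 = [::]] by split; apply: s0.
pose s1 := set_stack s 11 q.
have E1 : exec (mac 11 22 23) s (100 * X.+1 ^ 2) s1.
  have := @step 11 22 23 s erefl erefl erefl tm0; rewrite z11; apply.
  by rewrite /= /X; lia.
have tm1 : temps s1 by exact: temps_set.
pose s2 := set_stack s1 12 e.
have E2 : exec (mac 12 20 23) s1 (100 * X.+1 ^ 2) s2.
  have := @step 12 20 23 s1 erefl erefl erefl tm1.
  rewrite -[s1 12]/(s 12) z12; apply.
  by rewrite -[s1 20]/(s 20) -[s1 23]/(s 23) /= /X; lia.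
have tm2 : temps s2 by exact: temps_set.
pose s3 := set_stack s2 13 g.
have E3 : exec (mac 13 20 21) s2 (100 * X.+1 ^ 2) s3.
  have := @step 13 20 21 s2 erefl erefl erefl tm2.
  rewrite -[s2 13]/(s 13) z13; apply.
  by rewrite -[s2 20]/(s 20) -[s2 21]/(s 21) /= /X; lia.
have tm3 : temps s3 by exact: temps_set.
pose s4 := set_stack s3 8 (bin_mul q (s 4)).
have E4 : exec (mac 8 11 4) s3 (100 * X.+1 ^ 2) s4.
  have := @step 8 11 4 s3 erefl erefl erefl tm3.
  rewrite -[s3 8]/(s 8) z8; apply.
  by rewrite -[s3 11]/q -[s3 4]/(s 4) /= /X; lia.
have tm4 : temps s4 by exact: temps_set.
pose s5 := set_stack s4 8 (bin_comb q (s 4) e (s 6)).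
have E5 : exec (mac 8 12 6) s4 (100 * X.+1 ^ 2) s5.
  apply: (@step 8 12 6 s4 erefl erefl erefl tm4).
  rewrite -[s4 8]/(bin_mul q (s 4)) -[s4 12]/e -[s4 6]/(s 6) /X.
  by have := sqx _ sU; lia.
have tm5 : temps s5 by exact: temps_set.
pose s6 := set_stack s5 9 (bin_mul q (s 5)).
have E6 : exec (mac 9 11 5) s5 (100 * X.+1 ^ 2) s6.
  have := @step 9 11 5 s5 erefl erefl erefl tm5.
  rewrite -[s5 9]/(s 9) z9; apply.
  by rewrite -[s5 11]/q -[s5 5]/(s 5) /= /X; lia.
have tm6 : temps s6 by exact: temps_set.
pose s7 := set_stack s6 9 (bin_comb q (s 5) g (s 6)).
have E7 : exec (mac 9 13 6) s6 (100 * X.+1 ^ 2) s7.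
  apply: (@step 9 13 6 s6 erefl erefl erefl tm6).
  rewrite -[s6 9]/(bin_mul q (s 5)) -[s6 13]/g -[s6 6]/(s 6) /X.
  by have := sqx _ sV; lia.
have tm7 : temps s7 by exact: temps_set.
pose s8 := set_stack s7 10 (bin_mul q (s 6)).
have E8 : exec (mac 10 11 6) s7 (100 * X.+1 ^ 2) s8.
  have := @step 10 11 6 s7 erefl erefl erefl tm7.
  rewrite -[s7 10]/(s 10) z10; apply.
  by rewrite -[s7 11]/q -[s7 6]/(s 6) /= /X; lia.
exists s8; split=> //.
- apply: exec_le (exec_seq E1 (exec_seq E2 (exec_seq E3 (exec_seq E4 (exec_seq E5
    (exec_seq E6 (exec_seq E7 (exec_seq E8 (exec_skip _))))))))) _.
  by rewrite -/X; lia.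
- move=> r r14; rewrite -/X.
  have : r \in [:: 8; 9; 10; 11; 12; 13] by rewrite !inE; lia.
  rewrite !inE => /or4P[/eqP->|/eqP->|/eqP->|/or3P[]/eqP->].
  + exact: scomb.
  + exact: scomb.
  + by apply: leq_trans (sqx _ sD) _; rewrite /X; lia.
  + by rewrite -[s8 11]/q /X; lia.
  + by rewrite -[s8 12]/e /X; lia.
  + by rewrite -[s8 13]/g /X; lia.
- by move=> r rN; rewrite /s8 /s7 /s6 /s5 /s4 /s3 /s2 /s1 /set_stack; split_regs.
Qed.

(** The loop invariant. All stacks from 8 on are empty, so every call of an evaluation program finds
    a clean zone. *)
Definition main_store (dc dm k i U V D : bitstring) : store :=
  nth [::] [:: dc; dm; k; i; U; V; D; nseq (bin_lt U D) true].

Definition scratch (N : nat) : seq nat := [:: 4; 5; 6; 7; 11; 12; 13] ++ iota 20 N.*2.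

(** The comparison destroys stacks 8 and 10, which have been copied by then, and its carry register
    is stack 7 itself: the last borrow is directly the new loop flag. The two pushes increment
    precision and rank. *)
Definition reload : cmd :=
  foldr Seq Skip [:: copy 8 4; copy 9 5; copy 10 6; zip_loop borrow xor3 8 10 7 14;
    clear [:: 9; 14]; Push 2 true; Push 3 true].

Lemma exec_reload dc dm k i U V D X :
  size U <= X -> size V <= X -> size D <= X ->
  exec reload (nth [::] [:: dc; dm; k; i; [::]; [::]; [::]; [::]; U; V; D]) (100 * X + 100)
    (main_store dc dm (true :: k) (true :: i) U V D).
Proof.
move=> UX VX DX; set s := nth _ _.
have E1 := @exec_copy 8 4 s ltac:(by []) ltac:(by []) ltac:(by []) erefl erefl.
set s1 := set_stack _ _ _ in E1.
have E2 := @exec_copy 9 5 s1 ltac:(by []) ltac:(by []) ltac:(by []) erefl erefl.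
set s2 := set_stack _ _ _ in E2.
have E3 := @exec_copy 10 6 s2 ltac:(by []) ltac:(by []) ltac:(by []) erefl erefl.
set s3 := set_stack _ _ _ in E3.
have E4 := @exec_zip_loop borrow xor3 8 10 7 14 isT s3 false erefl.
rewrite -[s3 8]/U -[s3 10]/D -[s3 14]/([::] : bitstring) in E4.
pose n := maxn (size U) (size D).
have [d [o [E so]]] := iter_zstep_stacks borrow xor3 n false U D [::].
have dE : d = bin_lt U D by rewrite /bin_lt -/n E.
rewrite -/n E !drop_oversize ?leq_maxl ?leq_maxr // in E4.
set s4 := put _ _ _ _ _ _ in E4.
have := @exec_clear [:: 9; 14] s4 X.
move=> /(_ ltac:(by move=> r; rewrite !inE => /orP[]/eqP->; rewrite ?[s4 _]/o ?[s4 _]/V // so addn0 geq_max UX)).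
set s5 := (fun r => _) => E5.
have E6 := exec_push 2 true s5.
set s6 := set_stack _ _ _ in E6.
have E7 := exec_push 3 true s6.
set s7 := set_stack _ _ _ in E7.
have -> : main_store dc dm (true :: k) (true :: i) U V D = s7.
  by apply: funext; rewrite /main_store -dE; do 15 (case=> [//|]); case.
apply: exec_le (exec_seq E1 (exec_seq E2 (exec_seq E3 (exec_seq E4 (exec_seq E5
    (exec_seq E6 (exec_seq E7 (exec_skip _)))))))) _.
rewrite -[s 8]/U -[s1 9]/V -[s2 10]/D /=; lia.
Qed.

Section Body.
Variables P1 P2 : cmd.
Hypotheses (cf1 : coin_free P1) (cf2 : coin_free P2).

(** At least 3, since the inputs fill three stacks of a zone even if the program mentions fewer. *)
Definition zone_width : nat := maxn 3 (maxn (width P1) (width P2)).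

Definition body : cmd :=
  foldr Seq Skip [:: call false P1 0 3 2; call true P2 3 1 2; update_sums;
    clear (scratch zone_width); reload].

Definition body_time (X : nat) : nat := (2000 + 20 * zone_width) * X.+1 ^ 2.

Lemma exec_body dc dm k i U V D t1 t2 B H :
  let r1 := run P1 [:: dc; unary i; unary k] [::] t1 in
  let r2 := run P2 [:: unary i; dm; unary k] [::] t2 in
  halted r1 -> halted r2 ->
  size dc <= B -> size dm <= B -> k <= B -> i <= B -> t1 <= B -> t2 <= B ->
  size U <= H -> size V <= H -> size D <= H ->
  let q := bin_mul (r1.1.2 1) (r2.1.2 1) in
  exec body (main_store dc dm (unary k) (unary i) U V D) (body_time (H + 8 * B))
    (main_store dc dm (unary k.+1) (unary i.+1)
       (bin_comb q U (bin_mul (r1.1.2 0) (r2.1.2 1)) D)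
       (bin_comb q V (bin_mul (r1.1.2 0) (r2.1.2 0)) D) (bin_mul q D)).
Proof.
move=> r1 r2 hlt1 hlt2 dcB dmB kB iB t1B t2B UH VH DH q.
set s0 := main_store _ _ _ _ _ _ _.
have suk j : size (unary j) = j by rewrite size_nseq.
have s0z r : 8 <= r -> s0 r = [::] by move=> ?; rewrite /s0 /main_store nth_default.
have E1 : exec (call false P1 0 3 2) s0 (49 * B + 12) (embed (unzone false) s0 r1.1.2).
  apply: (@exec_call false P1 0 3 2 s0 t1) => //; rewrite /= ?suk //.
set s1 := embed _ _ _ in E1.
have s1E r : r < 20 -> s1 r = s0 r.
  by move=> r20; rewrite /s1 /embed /unzone leqNgt ltn_addr.
have s1z r : s1 (zone true r) = [::].
  rewrite /s1 /embed; case e : (unzone false _) => [q'|]; last by apply: s0z; rewrite /zone; lia.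
  by have := @unzoneK false (zone true r); rewrite e /= /zone; lia.
have E2 : exec (call true P2 3 1 2) s1 (49 * B + 12) (embed (unzone true) s1 r2.1.2).
  apply: (@exec_call true P2 3 1 2 s1 t2) => //; rewrite !s1E //=  ?suk //.
set s2 := embed _ _ _ in E2.
have s2E r : r < 20 -> s2 r = s0 r.
  move=> r20; rewrite -s1E // /s2 /embed /unzone (_ : (_ <= r) = false) //; lia.
have sz1 r : size (r1.1.2 r) <= 2 * B.
  apply: leq_trans (size_run _ _ _ _ _) _.
  by case: r => [|[|[|r]]] /=; rewrite ?nth_nil ?suk /=; lia.
have sz2 r : size (r2.1.2 r) <= 2 * B.
  apply: leq_trans (size_run _ _ _ _ _) _.
  by case: r => [|[|[|r]]] /=; rewrite ?nth_nil ?suk /=; lia.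
have sz r : 20 <= r -> size (s2 r) <= 2 * B.
  move=> r20; rewrite /s2 /embed; case: (unzone true r) => [q'|] //.
  by rewrite /s1 /embed; case: (unzone false r) => [q'|] //; rewrite s0z //; lia.
have [|||s3 [E3 sz3 s3E [s3_8 s3_9 s3_10]]] := @exec_update_sums s2 (2 * B) H.
- by move=> r r19; rewrite s2E; [apply: s0z|]; lia.
- by move=> r r24; apply: sz; lia.
- move=> r r7; rewrite s2E; last by lia.
  have : r \in [:: 4; 5; 6] by rewrite !inE; lia.
  by rewrite !inE => /or3P[]/eqP->.
rewrite -[s2 20]/(r1.1.2 0) -[s2 22]/(r1.1.2 1) -[s2 21]/(r2.1.2 0) -[s2 23]/(r2.1.2 1) in s3_8 s3_9 s3_10.
rewrite -/q -[s2 4]/U -[s2 5]/V -[s2 6]/D in s3_8 s3_9 s3_10.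
(* Answers have at most [2 * B] bits, and [update_sums] adds four times that. The next bound is
   [X.+1] because the flag on stack 7 may hold one bit even when [X] is 0. *)
pose X := H + 8 * B.
have szs r : r \in scratch zone_width -> size (s3 r) <= X.+1.
  rewrite mem_cat => /orP[|]; last first.
    rewrite mem_iota => r20; rewrite s3E; last by right; lia.
    by apply: leq_trans (sz _ _) _; rewrite /X; lia.
  rewrite !inE => /or4P[/eqP->|/eqP->|/eqP->|/or4P[]/eqP->].
  - by rewrite s3E; last left; rewrite // -[s2 4]/U /X; lia.
  - by rewrite s3E; last left; rewrite // -[s2 5]/V /X; lia.
  - by rewrite s3E; last left; rewrite // -[s2 6]/D /X; lia.
  - by rewrite s3E; last left; rewrite // -[s2 7]/(nseq (bin_lt U D) true) size_nseq; case: bin_lt.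
  - by apply: leq_trans (sz3 _ _) _; rewrite // /X; lia.
  - by apply: leq_trans (sz3 _ _) _; rewrite // /X; lia.
  - by apply: leq_trans (sz3 _ _) _; rewrite // /X; lia.
have := exec_clear szs.
have -> : (fun r => if r \in scratch zone_width then [::] else s3 r) =
   nth [::] [:: dc; dm; unary k; unary i; [::]; [::]; [::]; [::]; s3 8; s3 9; s3 10].
  apply: funext => r; have [r20|r20] := ltnP r 20.
    rewrite mem_cat mem_iota.
    have -> : (19 < r < 20 + zone_width.*2) = false by lia.
    rewrite orbF; move: r r20; do 4 (case=> [_|]; first by rewrite /= s3E //; left).
    do 10 (case=> [_ //=|]).
    by move=> r r20; rewrite s3E ?s2E ?s0z //= ?nth_nil //; right.
  (* From 20 on, a stack that is not cleared lies beyond the widths and the inputs of both programs,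
     so it is still empty by [run_width]. *)
  rewrite mem_cat mem_iota r20 nth_default //=; last by lia.
  case: ifP => // /norP[_ rN].
  rewrite s3E; last by right; lia.
  have le3 : 3 <= zone_width by exact: leq_maxl.
  have le1 : width P1 <= zone_width by rewrite /zone_width; lia.
  have le2 : width P2 <= zone_width by rewrite /zone_width; lia.
  rewrite /s2 /embed; have := @unzoneK true r; case: (unzone true r) => [q'|] /=.
    by rewrite /zone => rE; apply: run_width => /=; lia.
  move=> _; rewrite /s1 /embed; have := @unzoneK false r; case: (unzone false r) => [q'|] /=.
    by rewrite /zone => rE; apply: run_width => /=; lia.
  by move=> _; apply: s0z; lia.
have X8 r : 8 <= r < 14 -> size (s3 r) <= X by move=> ?; apply: leq_trans (sz3 _ _) _; rewrite // /X; lia.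
have := @exec_reload dc dm (unary k) (unary i) (s3 8) (s3 9) (s3 10) X (X8 8 isT) (X8 9 isT) (X8 10 isT).
rewrite s3_8 s3_9 s3_10 => E5 E4.
apply: exec_le (exec_seq E1 (exec_seq E2 (exec_seq E3 (exec_seq E4 (exec_seq E5 (exec_skip _)))))) _.
rewrite /body_time -/X (_ : 4 * (2 * B) = 8 * B) -/X; last by lia.
rewrite size_cat size_iota /=.
have leBX : B <= X by rewrite /X; lia.
rewrite -mulnn; move: zone_width => N; clearbody X; clear -leBX; nia.
Qed.
End Body.

Lemma bin_val_unary k : bin_val (unary k) = (2 ^ k).-1.
Proof.
elim: k => //= k ->; rewrite expnS.
by have := expn_gt0 2 k; lia.
Qed.

Lemma bin_val_mul x y : bin_val (bin_mul x y) = bin_val x * bin_val y.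
Proof. by rewrite bin_val_mac. Qed.

Lemma bin_val_comb q x e y :
  bin_val (bin_comb q x e y) = bin_val q * bin_val x + bin_val e * bin_val y.
Proof. by rewrite bin_val_mac bin_val_mul. Qed.

Lemma size_bin_comb q x e y S H : size q <= S -> size e <= S ->
  size x <= H -> size y <= H -> size (bin_comb q x e y) <= H + 2 * S.
Proof.
move=> qS eS xH yH; have := size_bin_mac (bin_mul q x) e y.
by have := size_bin_mul q x; rewrite /bin_comb; lia.
Qed.

(** * The complete program and its running time *)

Section Program.
Variables P1 P2 : cmd.
Hypotheses (cf1 : coin_free P1) (cf2 : coin_free P2).

(** Three pushes turn the unary [m] into the initial D, and a fourth into the first precision m + 4.
    Initially U is 1 and V is the empty numeral; the flag is set without a test because 1 < 2^(m +
    3) - 1 always holds. *)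
Definition program : cmd :=
  foldr Seq Skip [:: Push 2 true; Push 2 true; Push 2 true; copy 2 6;
    Push 2 true; Push 4 true; Push 7 true; While 7 (body P1 P2);
    clear [:: 0; 1]; copy 5 0; copy 6 1].

Definition program_time (B : nat) : nat :=
  let X := B + 8 * B * B + 8 * B in
  B * (body_time P1 P2 X).+1 + 100 * X + 100.

Variables (dc dm : bitstring) (m : nat) (t1 t2 : nat -> nat).

Let ans1 i := (run P1 [:: dc; unary i; unary (m + 4 + i)] [::] (t1 i)).1.2.
Let ans2 i := (run P2 [:: unary i; dm; unary (m + 4 + i)] [::] (t2 i)).1.2.

Fixpoint accs (i : nat) : bitstring * bitstring * bitstring :=
  if i is i'.+1 then
    let: (U, V, D) := accs i' in
    let q := bin_mul (ans1 i' 1) (ans2 i' 1) in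
    (bin_comb q U (bin_mul (ans1 i' 0) (ans2 i' 1)) D,
     bin_comb q V (bin_mul (ans1 i' 0) (ans2 i' 0)) D,
     bin_mul q D)
  else ([:: true], [::], unary (m + 3)).

Variables (j B : nat).
Hypotheses (jB : j <= B) (dcB : size dc <= B) (dmB : size dm <= B).
Hypothesis KB : m + 4 + j <= B.
Hypotheses (t1B : forall i, i < j -> t1 i <= B) (t2B : forall i, i < j -> t2 i <= B).
Hypothesis halt1 : forall i, i < j ->
  halted (run P1 [:: dc; unary i; unary (m + 4 + i)] [::] (t1 i)).
Hypothesis halt2 : forall i, i < j ->
  halted (run P2 [:: unary i; dm; unary (m + 4 + i)] [::] (t2 i)).

(** Answers have at most [2 * B] bits and their products [4 * B]; by [size_bin_comb] a round adds at
    most twice the latter. *)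
Lemma size_accs i : i <= j ->
  [/\ size (accs i).1.1 <= B + 8 * B * i, size (accs i).1.2 <= B + 8 * B * i
    & size (accs i).2 <= B + 8 * B * i].
Proof.
elim: i => [_|i IH ij] /=; first by rewrite size_nseq; split; lia.
have := IH (ltnW ij); case: (accs i) => [[U V] D] /= [UH VH DH].
have s1 r : size (ans1 i r) <= 2 * B.
  apply: leq_trans (size_run _ _ _ _ _) _; have := t1B ij.
  by case: r => [|[|[|r]]] /=; rewrite ?nth_nil ?size_nseq /=; lia.
have s2 r : size (ans2 i r) <= 2 * B.
  apply: leq_trans (size_run _ _ _ _ _) _; have := t2B ij.
  by case: r => [|[|[|r]]] /=; rewrite ?nth_nil ?size_nseq /=; lia.
have sM r r' : size (bin_mul (ans1 i r) (ans2 i r')) <= 4 * B.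
  by have := size_bin_mul (ans1 i r) (ans2 i r'); have := s1 r; have := s2 r'; lia.
have -> : B + 8 * B * i.+1 = B + 8 * B * i + 2 * (4 * B) by rewrite mulnS; lia.
split; try exact: size_bin_comb.
apply: leq_trans (size_bin_mul _ _) _; have := sM 1 1; lia.
Qed.

Let st i := let: (U, V, D) := accs i in
  main_store dc dm (unary (m + 4 + i)) (unary i) U V D.

Lemma exec_loop i : i <= j ->
  (forall i', i' < j -> bin_val (accs i').1.1 < bin_val (accs i').2) ->
  bin_val (accs j).2 <= bin_val (accs j).1.1 ->
  exec (While 7 (body P1 P2)) (st i)
    ((j - i) * (body_time P1 P2 (B + 8 * B * B + 8 * B)).+1).+1 (st j).
Proof.
move=> ij lt_acc le_acc; move e: (j - i) => h; elim: h i ij e => [|h IH] i ij e.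
  have -> : i = j by lia.
  apply: exec_le (exec_while0 _ _) _ => //.
  by move: le_acc; rewrite /st; case: (accs j) => [[U V] D]; rewrite /main_store /= bin_ltE leqNgt => /negPf->.
have ij' : i < j by lia.
have st7 : st i 7 <> [::].
  by move: (lt_acc _ ij'); rewrite /st; case: (accs i) => [[U V] D]; rewrite /main_store /= bin_ltE => ->.
have E1 : exec (body P1 P2) (st i) (body_time P1 P2 (B + 8 * B * B + 8 * B)) (st i.+1).
  have := size_accs ij; rewrite /st /=; case: (accs i) => [[U V] D] /= [UH VH DH].
  rewrite [m + 4 + i.+1]addnS; apply: exec_le (exec_body (B := B) (H := B + 8 * B * i) cf1 cf2 (halt1 ij') (halt2 ij') _ _ _ _ _ _ _ _ _) _ => //; try lia.
  - exact: t1B.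
  - exact: t2B.
  have iB : 8 * B * i <= 8 * B * B by rewrite leq_mul2l; lia.
  by rewrite /body_time leq_mul2l leq_exp2r //; apply/orP; right; lia.
by apply: exec_le (exec_while1 st7 E1 (IH i.+1 ij' _)) _; lia.
Qed.

(** [j] is the round at which the loop stops; evaluations of rank [j] or more are never started, so
    nothing is assumed about them. *)
Lemma exec_program :
  (forall i, i < j -> bin_val (accs i).1.1 < bin_val (accs i).2) ->
  bin_val (accs j).2 <= bin_val (accs j).1.1 ->
  exists s', [/\ exec program (nth [::] [:: dc; dm; unary m]) (program_time B) s',
    s' 0 = (accs j).1.2 & s' 1 = (accs j).2].
Proof.
move=> lt_acc le_acc; set s0 := nth _ _.
have E1 := exec_push 2 true s0; set s1 := set_stack _ _ _ in E1.
have E2 := exec_push 2 true s1; set s2 := set_stack _ _ _ in E2.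
have E3 := exec_push 2 true s2; set s3 := set_stack _ _ _ in E3.
have E4 := @exec_copy 2 6 s3 ltac:(by []) ltac:(by []) ltac:(by []) erefl erefl.
set s4 := set_stack _ _ _ in E4.
have E5 := exec_push 2 true s4; set s5 := set_stack _ _ _ in E5.
have E6 := exec_push 4 true s5; set s6 := set_stack _ _ _ in E6.
have E7 := exec_push 7 true s6; set s7 := set_stack _ _ _ in E7.
have s7E : s7 = st 0.
  apply: funext; rewrite /st /= addn0 /main_store bin_ltE bin_val_unary.
  have -> : bin_val [:: true] < (2 ^ (m + 3)).-1.
    by rewrite expnD /=; have := expn_gt0 2 m; lia.
  rewrite addn3 addn4 /unary.
  by do 8 (case=> [//|]); case.
have E8 := exec_loop (leq0n j) lt_acc le_acc; rewrite -s7E subn0 in E8.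
have [UH VH DH] := size_accs (leqnn j).
have stE : [/\ st j 0 = dc, st j 1 = dm, st j 5 = (accs j).1.2, st j 6 = (accs j).2 & forall r, 8 <= r -> st j r = [::]].
  rewrite /st; case: (accs j) => [[U V] D]; split=> //= r r8.
  by rewrite /main_store nth_default.
move: stE; set s8 := st j => -[s8_0 s8_1 s8_5 s8_6 s8N].
have E9 := @exec_clear [:: 0; 1] s8 B.
have {}E9 := E9 ltac:(by move=> r; rewrite !inE => /orP[]/eqP->; rewrite ?s8_0 ?s8_1).
set s9 := (fun r => _) in E9.
have E10 := @exec_copy 5 0 s9 ltac:(by []) ltac:(by []) ltac:(by []) (s8N 14 isT) erefl.
set s10 := set_stack _ _ _ in E10.
have E11 := @exec_copy 6 1 s10 ltac:(by []) ltac:(by []) ltac:(by []) (s8N 14 isT) erefl.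
set s11 := set_stack _ _ _ in E11.
exists s11; split=> //.
apply: exec_le (exec_seq E1 (exec_seq E2 (exec_seq E3 (exec_seq E4 (exec_seq E5
  (exec_seq E6 (exec_seq E7 (exec_seq E8 (exec_seq E9 (exec_seq E10 (exec_seq E11 (exec_skip _)))))))))))) _.
rewrite -[s3 2]/(true :: true :: true :: unary m) /= size_nseq.
rewrite -[s9 5]/(s8 5) -[s10 6]/(s8 6) s8_5 s8_6 /program_time.
have jB2 : 8 * B * j <= 8 * B * B by rewrite leq_mul2l jB orbT.
move: (body_time P1 P2 _).+1 => bt.
have : j * bt <= B * bt by rewrite leq_mul2r jB orbT.
move: VH DH jB2; move: (size _) (size _) (8 * B * B) (8 * B * j) (B * bt) (j * bt); lia.
Qed.
End Program.

(** * Polynomial bounds *)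

Definition poly_bounded (g : nat -> nat) : Prop :=
  exists c, forall N, g N <= poly_bound c N.

Lemma leq_poly_bound c N N' : N <= N' -> poly_bound c N <= poly_bound c N'.
Proof. by case: c => // c le_N; rewrite leq_mul2l leq_exp2r. Qed.

Lemma poly_bounded_cst k : poly_bounded (fun=> k).
Proof. by exists k => N; rewrite leq_pmulr // expn_gt0. Qed.

Lemma poly_bounded_id : poly_bounded id.
Proof. by exists 1 => N; rewrite /poly_bound expn1; lia. Qed.

Lemma poly_boundedD g h :
  poly_bounded g -> poly_bounded h -> poly_bounded (fun N => g N + h N).
Proof.
move=> [c gc] [d hd]; exists (c + d) => N; rewrite /poly_bound mulnDl.
by apply: leq_add; [apply: leq_trans (gc N) _ | apply: leq_trans (hd N) _];
  rewrite leq_mul2l leq_pexp2l ?orbT //; lia.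
Qed.

Lemma poly_boundedM g h :
  poly_bounded g -> poly_bounded h -> poly_bounded (fun N => g N * h N).
Proof.
(* The same constant is coefficient and exponent, so it has to dominate both [c * d] and [c + d]. *)
move=> [c gc] [d hd]; exists (c + d + c * d) => N.
apply: leq_trans (leq_mul (gc N) (hd N)) _.
rewrite /poly_bound mulnACA -expnD; apply: leq_mul; first by lia.
by rewrite leq_pexp2l //; lia.
Qed.

Lemma poly_boundedX g e : poly_bounded g -> poly_bounded (fun N => g N ^ e).
Proof.
move=> pg; elim: e => [|e IH].
  by case: (poly_bounded_cst 1) => c gc; exists c => N; rewrite expn0.
by case: (poly_boundedM pg IH) => c gc; exists c => N; rewrite expnS.
Qed.

Lemma poly_bounded_comp c g : poly_bounded g -> poly_bounded (fun N => poly_bound c (g N)).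
Proof.
move=> pg; apply: poly_boundedM; first exact: poly_bounded_cst.
apply: poly_boundedX; have [d hd] := poly_boundedD pg (poly_bounded_cst 1).
by exists d => N; rewrite -addn1.
Qed.

Lemma poly_bounded_program P1 P2 g :
  poly_bounded g -> poly_bounded (fun N => program_time P1 P2 (g N)).
Proof.
move=> pg; have cst := poly_bounded_cst.
have pX : poly_bounded (fun N => g N + 8 * g N * g N + 8 * g N).
  by do ![apply: poly_boundedD | apply: poly_boundedM].
apply: poly_boundedD => //; apply: poly_boundedD; apply: poly_boundedM => //.
have pT := poly_boundedM (cst (2000 + 20 * zone_width P1 P2)) (poly_boundedX 2 (poly_boundedD pX (cst 1))).
have [c gc] := poly_boundedD pT (cst 1).
by exists c => N; apply: leq_trans (gc N); rewrite addn1 /body_time addn1.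
Qed.

(** * Accuracy *)

Local Open Scope ring_scope.

(** A term with i < j is off by at most (P - p) F + p (F - f) in absolute value, that is [3 * e i],
    since p <= 1 and |F| <= 1 + e <= 2. The remaining [2 * d] is the mass beyond [j]: the stopping
    condition allows [d] for the slack, and the errors in P another [d]. *)
Lemma truncated_product_sum (R : realFieldType) (p f P F e : nat -> R) (j L : nat) (d : R) :
  (j <= L)%N ->
  (forall i, (i < L)%N -> [/\ 0 <= p i, 0 <= f i <= 1, 0 <= e i <= 1,
     `|P i - p i| <= e i & `|F i - f i| <= e i]) ->
  \sum_(0 <= i < L) p i = 1 ->
  \sum_(0 <= i < j) e i <= d ->
  1 <= d + \sum_(0 <= i < j) P i ->
  `|\sum_(0 <= i < j) P i * F i - \sum_(0 <= i < L) p i * f i| <= 5 * d.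
Proof.
move=> jL approx p1 ed stop.
have head : `|\sum_(0 <= i < j) (P i * F i - p i * f i)| <= 3 * d.
  apply: le_trans (_ : \sum_(0 <= i < j) 3 * e i <= _); last first.
    by rewrite -mulr_sumr ler_pM2l.
  apply: le_trans (ler_norm_sum _ _ _) _; rewrite big_nat [leRHS]big_nat.
  apply: ler_sum => i /andP[_ ij].
  have [p0 /andP[f0 f1] /andP[e0 e1] Pp Ff] := approx i (leq_trans ij jL).
  have p_le1 : p i <= 1.
    rewrite -p1 (big_cat_nat (n := i)) //=; last exact: ltnW (leq_trans ij jL).
    rewrite [X in _ + X]big_ltn ?(leq_trans ij jL) //.
    rewrite addrCA lerDl addr_ge0 // big_nat sumr_ge0 // => k /andP[_ ki].
      by case: (approx k) => //; apply: leq_trans jL; apply: ltn_trans ij.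
    by case: (approx k).
  have -> : P i * F i - p i * f i = (P i - p i) * F i + p i * (F i - f i) by ring.
  apply: le_trans (ler_normD _ _) _; rewrite !normrM.
  have F2 : `|F i| <= 2.
    have := ler_normD (F i - f i) (f i); rewrite subrK (ger0_norm f0) => FD; lra.
  rewrite (ger0_norm p0).
  have : `|P i - p i| * `|F i| <= e i * 2 by apply: ler_pM.
  have : p i * `|F i - f i| <= 1 * e i by apply: ler_pM.
  lra.
have tail : 0 <= \sum_(j <= i < L) p i * f i <= 2 * d.
  have pP : \sum_(0 <= i < j) P i - \sum_(0 <= i < j) p i <= d.
    rewrite -sumrB; apply: le_trans ed; rewrite big_nat [leRHS]big_nat.
    apply: ler_sum => i /andP[_ ij]; apply: le_trans (ler_norm _) _.
    by case: (approx i (leq_trans ij jL)).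
  move: p1; rewrite (big_cat_nat (n := j)) //= => p1.
  have : \sum_(j <= i < L) p i * f i <= \sum_(j <= i < L) p i.
    rewrite big_nat [leRHS]big_nat; apply: ler_sum => i /andP[_ iL].
    by case: (approx i iL) => p0 /andP[f0 f1] _ _ _; apply: ler_piMr.
  have : 0 <= \sum_(j <= i < L) p i * f i.
    rewrite big_nat sumr_ge0 // => i /andP[_ iL].
    by case: (approx i iL) => p0 /andP[f0 f1] _ _ _; apply: mulr_ge0.
  by move=> -> ?; rewrite /=; lra.
rewrite (big_cat_nat (n := j) (p := L)) //= opprD addrA -sumrB.
apply: le_trans (ler_normB _ _) _; case/andP: tail => t0 t1.
by rewrite (ger0_norm t0); lra.
Qed.

(** The sum telescopes: the induction is carried out on its exact value, from which the bound
    follows. *)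
Lemma sum_geom_half (R : realFieldType) (k j : nat) :
  \sum_(0 <= i < j) (2 : R) ^- (k + 1 + i) <= 2 ^- k.
Proof.
suff -> : \sum_(0 <= i < j) (2 : R) ^- (k + 1 + i) = 2 ^- k - 2 ^- (k + j).
  by rewrite gerBl invr_ge0 exprn_ge0.
elim: j => [|j IH]; first by rewrite big_nil addn0 subrr.
rewrite big_nat_recr //= {}IH -addnA add1n addnS exprS invfM.
by field; rewrite !expf_neq0 //= pnatr_eq0.
Qed.

(** * Correctness of the program on one state and one measurement *)

Section Simulation.
Variables (R : realType) (P1 P2 : cmd) (dc dm : bitstring) (m : nat).
Variables (t1 t2 : nat -> nat) (p f : nat -> R) (L B : nat).
Hypotheses (cf1 : coin_free P1) (cf2 : coin_free P2).

Let run1 i := run P1 [:: dc; unary i; unary (m + 4 + i)] [::] (t1 i).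
Let run2 i := run P2 [:: unary i; dm; unary (m + 4 + i)] [::] (t2 i).

Hypotheses (dcB : (size dc <= B)%N) (dmB : (size dm <= B)%N).
Hypothesis LB : (m + 4 + L <= B)%N.
Hypotheses (t1B : forall i, (i < L)%N -> (t1 i <= B)%N)
           (t2B : forall i, (i < L)%N -> (t2 i <= B)%N).
Hypothesis run1P : forall i, (i < L)%N -> outputs_within (run1 i) (p i) (2 ^- (m + 4 + i)).
Hypothesis run2P : forall i, (i < L)%N -> outputs_within (run2 i) (f i) (2 ^- (m + 4 + i)).
Hypothesis p_ge0 : forall i, (i < L)%N -> 0 <= p i.
Hypothesis f01 : forall i, (i < L)%N -> 0 <= f i <= 1.
Hypothesis p_sum : \sum_(0 <= i < L) p i = 1.

Let P i : R := (out_num (run1 i))%:R / (out_den (run1 i))%:R.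
Let F i : R := (out_num (run2 i))%:R / (out_den (run2 i))%:R.
Let d0 : R := ((2 ^ (m + 3)).-1)%:R.

Let acc := accs P1 P2 dc dm m t1 t2.

Lemma d0_gt0 : 0 < d0.
Proof. by rewrite ltr0n expnD; have := expn_gt0 2 m; lia. Qed.

Lemma acc_val i : (i <= L)%N ->
  [/\ (0 < bin_val (acc i).2)%N,
      (bin_val (acc i).1.1)%:R / (bin_val (acc i).2)%:R = d0^-1 + \sum_(0 <= k < i) P k
    & (bin_val (acc i).1.2)%:R / (bin_val (acc i).2)%:R = \sum_(0 <= k < i) P k * F k].
Proof.
elim: i => [_|i IH iL] /=.
  rewrite !big_nil bin_val_unary /= addr0 mul0r div1r; split=> //.
  by have := d0_gt0; rewrite ltr0n.
rewrite !big_nat_recr //= addrA.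
have := IH (ltnW iL); rewrite /acc /=; case: (accs _ _ _ _ _ _ _ i) => [[U V] D] /= [D0 <- <-].
have /and3P[_ b0 _] := run1P iL; have /and3P[_ c0 _] := run2P iL.
rewrite !bin_val_comb !bin_val_mul /P /F.
rewrite -[bin_val ((run P1 _ _ _).1.2 1)]/(out_den (run1 i)).
rewrite -[bin_val ((run P1 _ _ _).1.2 0)]/(out_num (run1 i)).
rewrite -[bin_val ((run P2 _ _ _).1.2 1)]/(out_den (run2 i)).
rewrite -[bin_val ((run P2 _ _ _).1.2 0)]/(out_num (run2 i)).
rewrite !natrD !natrM; split; first by rewrite !muln_gt0 b0 c0.
  by field; rewrite !pnatr_eq0 -!lt0n b0 c0 D0.
by field; rewrite !pnatr_eq0 -!lt0n b0 c0 D0.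
Qed.

Lemma approx i : (i < L)%N -> [/\ 0 <= p i, 0 <= f i <= 1, 0 <= (2 : R) ^- (m + 4 + i) <= 1,
  `|P i - p i| <= 2 ^- (m + 4 + i) & `|F i - f i| <= 2 ^- (m + 4 + i)].
Proof.
move=> iL; have /and3P[_ _ h1] := run1P iL; have /and3P[_ _ h2] := run2P iL.
split=> //; [exact: p_ge0 | exact: f01 |].
by rewrite invr_ge0 exprn_ge0 //= invf_le1 ?exprn_gt0 // exprn_ege1 // ler1n.
Qed.

Lemma error_sum i : \sum_(0 <= k < i) (2 : R) ^- (m + 4 + k) <= d0^-1.
Proof.
rewrite (eq_bigr (fun k => (2 : R) ^- (m + 3 + 1 + k))); last by move=> k _; rewrite -(addnA m 3 1).
apply: le_trans (sum_geom_half _ _ _) _.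
by rewrite lef_pV2 ?posrE ?d0_gt0 ?exprn_gt0 // -natrX ler_nat leq_pred.
Qed.

Lemma stopE i : (i <= L)%N ->
  (bin_val (acc i).2 <= bin_val (acc i).1.1)%N = (1 <= d0^-1 + \sum_(0 <= k < i) P k).
Proof.
by case/acc_val=> D0 <- _; rewrite ler_pdivlMr ?ltr0n // mul1r ler_nat.
Qed.

Lemma exec_simulation : exists s',
  [/\ exec (program P1 P2) (nth [::] [:: dc; dm; unary m]) (program_time P1 P2 B) s',
      (0 < bin_val (s' 1%N))%N
    & `|(bin_val (s' 0%N))%:R / (bin_val (s' 1%N))%:R - \sum_(0 <= i < L) p i * f i|
        <= 5 / d0].
Proof.
have stopL : (bin_val (acc L).2 <= bin_val (acc L).1.1)%N.
  rewrite stopE // addrC -lerBlDr -p_sum lerBlDr -lerBlDl -sumrB.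
  apply: le_trans (error_sum L); rewrite big_nat [leRHS]big_nat.
  apply: ler_sum => i /andP[_ iL]; apply: le_trans (ler_norm _) _.
  by rewrite distrC; case: (approx iL).
have stop_ex : exists j, (bin_val (acc j).2 <= bin_val (acc j).1.1)%N by exists L.
(* Minimality of [j] gives both the loop guard in all earlier rounds and [j <= L], so that only
   evaluations at genuine ontic states occur. *)
have [j stop_j min_j] := ex_minnP stop_ex.
have jL : (j <= L)%N by exact: min_j.
have lt_j i : (i < j)%N -> (i < L)%N by move=> ij; apply: leq_trans jL.
have jB : (j <= B)%N by lia.
have KB : (m + 4 + j <= B)%N by lia.
have [||||||s' [Es' s'0 s'1]] := @exec_program P1 P2 cf1 cf2 dc dm m t1 t2 j B jB dcB dmB KB.
- by move=> i /lt_j /t1B.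
- by move=> i /lt_j /t2B.
- by move=> i /lt_j /run1P /and3P[].
- by move=> i /lt_j /run2P /and3P[].
- by move=> i ij; rewrite ltnNge; apply/negP => /min_j; rewrite leqNgt ij.
- exact: stop_j.
have [D0 _ valV] := acc_val jL.
exists s'; rewrite s'0 s'1; split=> //.
rewrite valV; apply: truncated_product_sum approx p_sum (error_sum j) _ => //.
by rewrite -stopE.
Qed.
End Simulation.

(** * From the single run to efficient simulability *)

Lemma coin_probT (R : realType) T (A : pred (T.-tuple bool)) :
  (forall w, A w) -> coin_prob R A = 1.
Proof.
move=> AT; rewrite /coin_prob (eq_card (B := predT)); last by move=> w; rewrite !inE; exact: AT.
by rewrite card_tuple card_bool natrX divff // expf_neq0 // pnatr_eq0.
Qed.

Lemma inv_accuracyP (R : realType) (eps : R) : 0 < eps ->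
  5 / ((2 ^ (inv_accuracy eps + 3)).-1)%:R <= eps.
Proof.
move=> eps0; set m := inv_accuracy eps.
have m_gt : eps^-1 < m%:R by rewrite /m /inv_accuracy truncnS_gt.
(* From m < 2^m, the right-hand side is at least 8 (m + 1) - 1; the shift by 3 thus absorbs the
   factor 5 of the error bound. *)
have le1 : (5 * m <= (2 ^ (m + 3)).-1)%N.
  by rewrite expnD; have := ltn_expl m (isT : (1 < 2)%N); lia.
have m0 : 0 < m%:R :> R by rewrite ltr0n.
apply: le_trans (_ : m%:R^-1 <= _); last first.
  by rewrite -[leRHS]invrK lef_pV2 ?posrE ?invr_gt0 // ltW.
have d0 : 0 < ((2 ^ (m + 3)).-1)%:R :> R.
  by rewrite ltr0n; apply: leq_trans le1; rewrite muln_gt0.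
by rewrite ler_pdivrMr // mulrC ler_pdivlMr // -natrM ler_nat.
Qed.

Local Open Scope classical_set_scope.

Theorem theorem3 (R : realType)
    (C M : forall n : nat, set (op R n))
    (dC dM : forall n : nat, op R n -> bitstring)
    (C_states : forall n : nat, C n `<=` @is_state R n)
    (M_effects : forall n : nat, M n `<=` @is_effect R n) :
  efficient_ontological_model C M dC dM -> efficiently_simulable C M dC dM.
Proof.
case=> descC descM [L [p [f [model [cL leL] [P1 cf1 [c1 run1]] [P2 cf2 [c2 run2]]]]]].
split=> //; have [[_ [cC leC]] [_ [cM leM]]] := (descC, descM).
(* At N = n + m, [K] dominates n + (m + 4 + i) for every rank i, hence the argument of each
   evaluation time bound; [B] then dominates all lengths, ranks, precisions and times at once. *)
pose K N := (N + 4 + poly_bound cL N)%N.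
pose B N := (poly_bound cC N + poly_bound cM N + K N
             + poly_bound c1 (K N) + poly_bound c2 (K N))%N.
have [c timeB] : poly_bounded (fun N => program_time P1 P2 (B N)).
  have pK : poly_bounded K.
    apply: poly_boundedD; last exact: poly_bounded_comp poly_bounded_id.
    exact: poly_boundedD poly_bounded_id (poly_bounded_cst 4).
  apply: poly_bounded_program.
  by do !apply: poly_boundedD => //; apply: poly_bounded_comp => //; exact: poly_bounded_id.
exists (program P1 P2), c => n eps rho E eps0 Crho ME m T result.
have [f01 p_prob trE] := model n; have [p_ge0 p_sum] := p_prob rho Crho.
(* Functions on ontic states become functions of the rank; the default 0 lies outside all sums,
   which stop at [#|L n|]. *)
pose ext (g : L n -> R) i : R := if insub i is Some o then g (enum_val (o : 'I_#|L n|)) else 0.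
have extE g (o : 'I_#|L n|) : ext g o = g (enum_val o) by rewrite /ext valK.
have sum_ext g : \sum_(0 <= i < #|L n|) ext g i = \sum_lam g lam.
  rewrite big_mkord [RHS](reindex_onto enum_val enum_rank) => [|lam _]; last exact: enum_rankK.
  by apply: eq_big => o; rewrite ?enum_valK ?eqxx // extE.
have ext_ord g k : (k < #|L n|)%N -> exists2 lam, ext g k = g lam & k = enum_rank lam.
  by move=> kL; exists (enum_val (Ordinal kL)); rewrite ?enum_valK // -[k]/(val (Ordinal kL)) extE.
pose t1 i := poly_bound c1 (n + (m + 4 + i)).
pose t2 i := poly_bound c2 (n + (m + 4 + i)).
have leLN : (#|L n| <= poly_bound cL (n + m))%N.
  by apply: leq_trans (leL n) _; apply: leq_poly_bound; rewrite leq_addr.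
have tK cc i : (i < #|L n|)%N -> (poly_bound cc (n + (m + 4 + i)) <= poly_bound cc (K (n + m)))%N.
  by move=> iL; apply: leq_poly_bound; rewrite /K; lia.
have dcB : (size (dC n rho) <= B (n + m))%N.
  by apply: leq_trans (leC n rho Crho) _; have := leq_poly_bound cC (leq_addr m n); rewrite /B; lia.
have dmB : (size (dM n E) <= B (n + m))%N.
  by apply: leq_trans (leM n E ME) _; have := leq_poly_bound cM (leq_addr m n); rewrite /B; lia.
have LB : (m + 4 + #|L n| <= B (n + m))%N by rewrite /B /K; lia.
have t1B i : (i < #|L n|)%N -> (t1 i <= B (n + m))%N.
  by move=> /(tK c1); rewrite /t1 /B; lia.
have t2B i : (i < #|L n|)%N -> (t2 i <= B (n + m))%N.
  by move=> /(tK c2); rewrite /t2 /B; lia.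
have [|||||s' [[t le_t exec_s'] den_gt0 err]] :=
  @exec_simulation R P1 P2 (dC n rho) (dM n E) m t1 t2 (ext (p n rho)) (ext ((f n)^~ E)) #|L n|
    (B (n + m)) cf1 cf2 dcB dmB LB t1B t2B.
- by move=> i iL; have [lam -> iE] := ext_ord (p n rho) i iL; rewrite [in unary i]iE; exact: run1.
- by move=> i iL; have [lam -> iE] := ext_ord ((f n)^~ E) i iL; rewrite [in unary i]iE; exact: run2.
- by move=> i iL; have [lam -> _] := ext_ord (p n rho) i iL.
- by move=> i iL; have [lam -> _] := ext_ord ((f n)^~ E) i iL; exact: f01.
- by rewrite sum_ext.
have runE v : run (program P1 P2) [:: dC n rho; dM n E; unary m] v T = ([::], s', v).
  have tT : (t <= T)%N by apply: leq_trans le_t (timeB _).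
  by rewrite /run -(subnK tT) iterD exec_s' iter_step_halted.
have expE : expval E rho = \sum_(0 <= i < #|L n|) ext (p n rho) i * ext ((f n)^~ E) i.
  (* The model gives the trace of rho E and [expval] uses E rho, hence the cyclicity of the trace;
     the real part of the embedded real sum is the sum itself. *)
  rewrite /expval mxtrace_mulC trE //= -sum_ext [LHS]big_nat [RHS]big_nat.
  by apply: eq_bigr => k /andP[_ kL]; rewrite -[k]/(val (Ordinal kL)) !extE.
split=> [w|]; first by rewrite /result runE.
rewrite coin_probT; first by lra.
move=> w; rewrite /result runE /outputs_within /= den_gt0 expE /=.
exact: le_trans err (inv_accuracyP eps0).
Qed.
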